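(* Let $(z_k)=((x_k,y_k))$, together with $(\bar x_k)$, be generated by PDHG (in its Tri-PD form) with adaptive step sizes as described in the context: the step sizes are updated only when the squared residual has decreased by at least a factor $\delta>0$ since the previous update, and at each update the primal and dual step sizes are multiplied by $r$ and $1/r$ respectively or by $1/r$ and $r$ respectively, where $r>1$ and $\delta r<1$. Then the feasibility gap and the optimality gap converge to $0$: $$\operatorname{dist}(A\bar x_{k},\operatorname{dom} g)\underset{k\to+\infty}{\longrightarrow}0,\qquad f(\bar x_{k})+f_2(\bar x_{k})+g\big(\operatorname{proj}_{\operatorname{dom} g}(A\bar x_{k})\big)-P^*\underset{k\to+\infty}{\longrightarrow}0.$$
   Context: Problem. $A$ is a real $m\times n$ matrix, $f:\mathbb R^n\to\mathbb R\cup\{+\infty\}$ and $g:\mathbb R^m\to\mathbb R\cup\{+\infty\}$ are proper convex lower semicontinuous, $f_2:\mathbb R^n\to\mathbb R$ is convex and differentiable with $L_f$-Lipschitz gradient. One assumes $0\in\mathrm{ri}(\operatorname{dom} g-A(\operatorname{dom} f))$. The saddle point problem is $\min_{x\in\mathbb R^n}\max_{y\in\mathbb R^m} f(x)+f_2(x)+\langle Ax,y\rangle-g^*(y)$, where $g^*$ is the Fenchel conjugate of $g$; it has at least one saddle point $z_*=(x_*,y_* )$, and $P^*=f(x_* )+f_2(x_* )+g(Ax_* )$. The function $g$ is Lipschitz continuous on its domain (it is the sum of a Lipschitz continuous function and the indicator of a convex set). Iteration (Tri-PD version of PDHG). From $z_0=(x_0,y_0)$, with step sizes $\tau_k,\sigma_k>0$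 satisfying $\sigma_k\tau_k\|A\|^2<1$ and $\tau_kL_f<2$ for all $k$, where $\|A\|$ is the operator norm of $A$: $$\bar x_{k+1}=\operatorname{prox}_{\tau_kf}(x_k-\tau_k\nabla f_2(x_k)-\tau_kA^\top y_k),\quad y_{k+1}=\operatorname{prox}_{\sigma_kg^*}(y_k+\sigma_kA\bar x_{k+1}),\quad x_{k+1}=\bar x_{k+1}-\tau_kA^\top(y_{k+1}-y_k).$$ Here $\operatorname{prox}_{h}(v)=\arg\min_{u} h(u)+\frac12\|u-v\|^2$. Step size rule. There are update instants $0=s_0<s_1<s_2<\dots$ (finitely or infinitely many), and $(\tau_k,\sigma_k)=(\tau_{s_l},\sigma_{s_l})$ for $s_l\le k<s_{l+1}$ (for all $k\ge s_l$ if $s_l$ is the last instant). At each update, $\tau_{s_{l+1}}=\tau_{s_l}r^{u_{l+1}}$ and $\sigma_{s_{l+1}}=\sigma_{s_l}r^{-u_{l+1}}$ with $u_{l+1}\in\{-1,+1\}$. Let $\|z\|_{V_{s_l}}^2=\frac1{\tau_{s_l}}\|x\|^2+\frac1{\sigma_{s_l}}\|y\|^2$ for $z=(x,y)$. An update may take place at $s_{l+1}$ only if the squared residual has decreased by at least a factor $\delta$, that is $$\|z_{s_{l+1}}-z_{s_{l+1}-1}\|_{V_{s_l}}^2\le\delta\,\|z_{s_l}-z_{s_l-1}\|_{V_{s_{l-1}}}^2\quad(l\ge1),\qquad \|z_{s_1}-z_{s_1-1}\|_{V_{s_0}}^2\le\delta\,\|z_1-z_0\|_{V_{s_0}}^2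 .$$ Subject to this, the instants $s_l$ and the directions $u_l$ are selected by the algorithm from estimates of the convergence rate computed from the past iterates. *)

(* Defs.v *)
From HB Require Import structures.
From mathcomp Require Import all_boot all_order all_algebra.
From mathcomp Require Import all_classical all_reals all_analysis.

Set Implicit Arguments.
Unset Strict Implicit.
Unset Printing Implicit Defensive.

Import Order.TTheory GRing.Theory Num.Theory.
Import numFieldNormedType.Exports.

Local Open Scope classical_set_scope.
Local Open Scope ring_scope.

(* Vectors are columns.  The norm that the library puts on matrices is the
   sup norm; it induces the usual topology, but every metric notion below uses
   the Euclidean norm [enorm]. *)
Section Euclidean.
Variables (R : realType) (n : nat).
Implicit Types u v w : 'cV[R]_n.

Definition dotv u v : R := \sum_i u i ord0 * v i ord0.

Definition enorm u : R := Num.sqrt (dotv u u).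

Definition distance_to (C : set 'cV[R]_n) v : R :=
  inf [set enorm (v - w) | w in C].

(* The default value of [get] is never reached when [C] is nonempty and
   closed. *)
Definition proj_on (C : set 'cV[R]_n) v : 'cV[R]_n :=
  get [set p | C p /\ forall w, C w -> enorm (v - p) <= enorm (v - w)].

Definition affine_set (S : set 'cV[R]_n) : Prop :=
  forall u v (t : R), S u -> S v -> S ((1 - t) *: u + t *: v).

Definition affine_hull (C : set 'cV[R]_n) : set 'cV[R]_n :=
  smallest affine_set C.

Definition relint (C : set 'cV[R]_n) : set 'cV[R]_n :=
  [set c | C c /\ exists2 e : R, 0 < e &
     forall w, affine_hull C w -> enorm (w - c) < e -> C w].

(* This is the gradient at the points where [h] is differentiable. *)
Definition grad (h : 'cV[R]_n -> R) u : 'cV[R]_n :=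
  \col_i 'D_(delta_mx i ord0) h u.

End Euclidean.

Definition opnorm (R : realType) (m n : nat) (A : 'M[R]_(m, n)) : R :=
  sup [set enorm (A *m x) | x in [set x : 'cV[R]_n | enorm x <= 1]].

Section ExtendedValued.
Variables (R : realType) (n : nat).
Implicit Types (h : 'cV[R]_n -> \bar R) (u v w : 'cV[R]_n).
Local Open Scope ereal_scope.

Definition edom h : set 'cV[R]_n := [set u | h u < +oo].

Definition eproper h : Prop :=
  (forall u, h u != -oo) /\ (exists u, edom h u).

Definition econvex h : Prop :=
  forall u v (t : R), (0 < t < 1)%R ->
    h ((1 - t) *: u + t *: v)%R <= (1 - t)%:E * h u + t%:E * h v.

Definition fenchel_conj h v : \bar R :=
  ereal_sup [set (dotv u v)%:E - h u | u in [set: 'cV[R]_n]].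

(* Minimizers of [h u + |u - v|^2 / 2], as a set; it is a singleton when [h]
   is proper, convex and lower semicontinuous. *)
Definition prox h v : set 'cV[R]_n :=
  [set p | forall u, h p + (2^-1 * enorm (p - v) ^+ 2)%:E <=
                     h u + (2^-1 * enorm (u - v) ^+ 2)%:E].

Definition lipschitz_on_edom h : Prop :=
  exists L : R, forall u v, edom h u -> edom h v ->
    (`|fine (h u) - fine (h v)| <= L * enorm (u - v))%R.

End ExtendedValued.

Section Problem.
Variables (R : realType) (m n : nat) (A : 'M[R]_(m, n)).
Variables (f : 'cV[R]_n -> \bar R) (f2 : 'cV[R]_n -> R).
Variable g : 'cV[R]_m -> \bar R.

Definition lagrangian (x : 'cV[R]_n) (y : 'cV[R]_m) : \bar R :=
  (f x + (f2 x)%:E + (dotv (A *m x) y)%:E - fenchel_conj g y)%E.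

(* Requiring [xs] and [ys] to be in the domains ensures that no [+oo - oo]
   arises in the inequalities. *)
Definition saddle_point (xs : 'cV[R]_n) (ys : 'cV[R]_m) : Prop :=
  [/\ edom f xs, edom (fenchel_conj g) ys &
      forall x y, (lagrangian xs y <= lagrangian xs ys)%E /\
                  (lagrangian xs ys <= lagrangian x ys)%E].

Variables (tau sigma : nat -> R).
Variables (x xbar : nat -> 'cV[R]_n) (y : nat -> 'cV[R]_m).

(* [xbar 0] is unconstrained: the sequence starts at index [1]. *)
Definition tri_pd : Prop := forall k : nat,
  [/\ prox (fun u => (tau k)%:E * f u)%E
        (x k - tau k *: grad f2 (x k) - tau k *: (A^T *m y k)) (xbar k.+1),
      prox (fun v => (sigma k)%:E * fenchel_conj g v)%E
        (y k + sigma k *: (A *m xbar k.+1)) (y k.+1) &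
      x k.+1 = xbar k.+1 - tau k *: (A^T *m (y k.+1 - y k))].

Definition sqnormV (t s : R) (dx : 'cV[R]_n) (dy : 'cV[R]_m) : R :=
  t^-1 * enorm dx ^+ 2 + s^-1 * enorm dy ^+ 2.

(* Squared residual at iteration [k >= 1], in the metric of the step sizes in
   force at iteration [j]. *)
Definition sqres (j k : nat) : R :=
  sqnormV (tau j) (sigma j) (x k - x k.-1) (y k - y k.-1).

(* The update instants are [s 0, ..., s q] if [N = Some q], and all the [s l]
   if [N = None]; the other values of [s] and [u] are irrelevant. *)
Definition is_instant (N : option nat) (l : nat) : bool :=
  if N is Some q then (l <= q)%N else true.

(* No further condition is put on the way in which instants and directions are
   selected. *)
Definition adaptive_steps (r delta : R) (N : option nat) (s : nat -> nat)
    (u : nat -> int) : Prop :=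
  [/\ s 0%N = 0%N,
      forall l k, is_instant N l -> (s l <= k)%N ->
        (is_instant N l.+1 -> (k < s l.+1)%N) ->
        tau k = tau (s l) /\ sigma k = sigma (s l),
      forall l, is_instant N l.+1 ->
        [/\ (s l < s l.+1)%N,
            u l.+1 = 1 \/ u l.+1 = -1,
            tau (s l.+1) = tau (s l) * r ^ (u l.+1) &
            sigma (s l.+1) = sigma (s l) * r ^ (- u l.+1)],
      is_instant N 1 -> sqres (s 0%N) (s 1%N) <= delta * sqres (s 0%N) 1 &
      forall l, (0 < l)%N -> is_instant N l.+1 ->
        sqres (s l) (s l.+1) <= delta * sqres (s l.-1) (s l)].

End Problem.

(* Main.v *)
(* Measure everything in the norm [V_k] of the current step sizes.  One step is
   nonexpansive in this norm, so within a phase of constant step sizes both the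
   squared residual [rho_k] and the squared distance [D_k] to the saddle point
   decrease.  At an update, [D_k] grows at most by the factor [r], and [rho_k] at
   most by a constant [C] independent of the phase.  The update rule therefore
   gives [rho_k <= C delta^l rho_0] and [D_k <= r^l D_0] in phase [l], and
   [1 / sigma_k <= r^l / sigma_0].  The feasibility gap is at most
   [|y_(k+1) - y_k| / sigma_k], whose square is at most [rho_k / sigma_k], and
   the optimality gap is controlled by this and by the products
   [sqrt (rho_k D_k)]; all these go to 0 because [delta r < 1].  If there are only
   finitely many phases, the residuals are summable in the last one. *)

Require Import Defs.
From HB Require Import structures.
From mathcomp Require Import all_boot all_order all_algebra.
From mathcomp Require Import all_classical all_reals all_analysis.
From mathcomp Require Import ring lra.
Import Order.TTheory GRing.Theory Num.Theory.
Import numFieldNormedType.Exports.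
Local Open Scope classical_set_scope.
Local Open Scope ring_scope.

Set Implicit Arguments.
Unset Strict Implicit.
Unset Printing Implicit Defensive.

(** * Euclidean space and operator norm *)

(** Nonexpansiveness compares two steps of equal sizes, so it says nothing about the residual across
    an update. There, two consecutive steps are compared through the monotonicity of the two
    subdifferentials, and the step-size conditions leave a constant that depends on [r] only, namely
    [216 * r]. This constant does not accumulate over the phases: the update rule tests the last
    residual of each phase, still in the metric of that phase, so the tested residuals form a chain
    into which [C] never enters; it is paid once, after the latest update. Hence [delta ^+ l] alone
    has to beat the growth [r ^+ l] of the distance. A second obstacle is that [A *m xbar k] may lie
    outside the domain of [g]. The inclusion defining the dual step provides the nearby point
    [A xbar_(k+1) + (y_k - y_(k+1)) / sigma_k], which does lie in the domain, and Lipschitz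
    continuity moves the value of [g] from there to the projection. *)

Section EuclideanSpace.
Variables (R : realType) (n : nat).
Implicit Types u v w : 'cV[R]_n.

Lemma dotvE u v : dotv u v = (u^T *m v) ord0 ord0.
Proof. by rewrite !mxE; apply: eq_bigr => i _; rewrite mxE. Qed.

Lemma dotvC u v : dotv u v = dotv v u.
Proof. by apply: eq_bigr => i _; rewrite mulrC. Qed.

Lemma dotvDr u v w : dotv u (v + w) = dotv u v + dotv u w.
Proof. by rewrite !dotvE mulmxDr mxE. Qed.

Lemma dotvDl u v w : dotv (v + w) u = dotv v u + dotv w u.
Proof. by rewrite dotvC dotvDr !(dotvC u). Qed.

Lemma dotvZr (c : R) u v : dotv u (c *: v) = c * dotv u v.
Proof. by rewrite !dotvE -scalemxAr mxE. Qed.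

Lemma dotvZl (c : R) u v : dotv (c *: u) v = c * dotv u v.
Proof. by rewrite dotvC dotvZr dotvC. Qed.

Lemma dotvNr u v : dotv u (- v) = - dotv u v.
Proof. by rewrite -scaleN1r dotvZr mulN1r. Qed.

Lemma dotvNl u v : dotv (- u) v = - dotv u v.
Proof. by rewrite dotvC dotvNr dotvC. Qed.

Lemma dotvBr u v w : dotv u (v - w) = dotv u v - dotv u w.
Proof. by rewrite dotvDr dotvNr. Qed.

Lemma dotvBl u v w : dotv (v - w) u = dotv v u - dotv w u.
Proof. by rewrite dotvDl dotvNl. Qed.

Lemma dotv0r u : dotv u 0 = 0.
Proof. by rewrite dotvE mulmx0 mxE. Qed.

Definition dotv_linE :=
  (dotvBl, dotvBr, dotvDl, dotvDr, dotvNl, dotvNr, dotvZl, dotvZr).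

Lemma dotv_ge0 u : 0 <= dotv u u.
Proof. by apply: sumr_ge0 => i _; rewrite -expr2 sqr_ge0. Qed.

Lemma coord_sqr_le u i : u i ord0 ^+ 2 <= dotv u u.
Proof.
rewrite /dotv (bigD1 i) //= -expr2 lerDl.
by apply: sumr_ge0 => j _; rewrite -expr2 sqr_ge0.
Qed.

Lemma dotv_eq0 u : dotv u u = 0 -> u = 0.
Proof.
move=> u0; apply/matrixP => i j; rewrite ord1 mxE; apply/eqP.
by rewrite -sqrf_eq0 eq_le sqr_ge0 andbT -u0 coord_sqr_le.
Qed.

Lemma sqr_enorm u : enorm u ^+ 2 = dotv u u.
Proof. by rewrite sqr_sqrtr // dotv_ge0. Qed.

Lemma enorm_ge0 u : 0 <= enorm u.
Proof. exact: sqrtr_ge0. Qed.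

Lemma enorm0 : enorm (0 : 'cV[R]_n) = 0.
Proof. by rewrite /enorm dotv0r sqrtr0. Qed.

Lemma enormB u v : enorm (u - v) = enorm (v - u).
Proof. by rewrite /enorm !dotv_linE; congr Num.sqrt; ring. Qed.

Lemma enormZ (c : R) u : enorm (c *: u) = `|c| * enorm u.
Proof.
by rewrite /enorm dotvZl dotvZr mulrA sqrtrM ?sqrtr_sqr // -expr2 sqr_ge0.
Qed.

Lemma young (c : R) u v : 0 < c ->
  2 * dotv u v <= c * dotv u u + c^-1 * dotv v v.
Proof.
move=> c0; have := dotv_ge0 (c *: u - v); rewrite !dotv_linE (dotvC v u) => h.
rewrite -(ler_pM2l c0); have -> : c * (c * dotv u u + c^-1 * dotv v v) =
  c * (c * dotv u u) + dotv v v by field; rewrite gt_eqF.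
by lra.
Qed.

Lemma cauchy_schwarz_sqr u v : dotv u v ^+ 2 <= dotv u u * dotv v v.
Proof.
have [v0|vn0] := eqVneq (dotv v v) 0.
  by rewrite (dotv_eq0 v0) !dotv0r expr0n mulr0.
have vp : 0 < dotv v v by rewrite lt_neqAle eq_sym vn0 dotv_ge0.
have := dotv_ge0 (dotv v v *: u - dotv u v *: v).
rewrite !dotv_linE (dotvC v u) => h.
by rewrite -subr_ge0 -(pmulr_rge0 _ vp); move: h; congr (0 <= _); ring.
Qed.

Lemma cauchy_schwarz u v : `|dotv u v| <= enorm u * enorm v.
Proof.
by rewrite /enorm -sqrtrM ?dotv_ge0 // -sqrtr_sqr ler_wsqrtr // cauchy_schwarz_sqr.
Qed.

Lemma enormD u v : enorm (u + v) <= enorm u + enorm v.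
Proof.
rewrite -ler_sqr ?nnegrE ?addr_ge0 ?enorm_ge0 // sqrrD !sqr_enorm.
have := le_trans (ler_norm _) (cauchy_schwarz u v).
by rewrite !dotv_linE (dotvC v u); lra.
Qed.

Lemma enorm_triangle u v w : enorm (u - w) <= enorm (u - v) + enorm (v - w).
Proof. by rewrite -(subrKA v u (- w)); apply: enormD. Qed.

Lemma enorm_le_sqr u (c : R) : 0 <= c -> dotv u u <= c ^+ 2 -> enorm u <= c.
Proof. by move=> c0; rewrite -sqr_enorm ler_sqr ?nnegrE ?enorm_ge0. Qed.

Lemma sqr_dist_continuous (c : 'cV[R]_n) :
  continuous (fun v : 'cV[R]_n => dotv (v - c) (v - c)).
Proof.
move=> v.
have ci i : (fun w : 'cV[R]_n => (w - c) i ord0) @ v --> (v - c) i ord0.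
  have -> : (fun w : 'cV[R]_n => (w - c) i ord0) = (fun w => w i ord0 - c i ord0).
    by apply/funext => w; rewrite !mxE.
  rewrite !mxE; apply: (@cvgB _ _ _ (nbhs v)); last exact: cvg_cst.
  exact: (@coord_continuous R n 1 i ord0 v).
apply: (@cvg_big _ _ _ _ _ _ _ (nbhs v)) => [|i _]; first exact: add_continuous.
exact: (@cvgM _ _ (nbhs v)) (ci i) (ci i).
Qed.

(** The ball is a closed part of a compact box, carried over from row vectors by transposition. The
    half-width [M + 1] works because [t ^+ 2 <= M] forces [|t| <= M + 1], which avoids a square
    root. *)
Lemma eball_compact (c : 'cV[R]_n) (M : R) :
  compact [set v : 'cV[R]_n | dotv (v - c) (v - c) <= M].
Proof.
set K := [set _ | _].
pose I i := `[c i ord0 - (M + 1), c i ord0 + (M + 1)]%classic.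
have cS : compact [set w : 'rV[R]_n | forall i, I i (w ord0 i)].
  by apply: rV_compact => i; exact: segment_compact.
have tr_cont k l : continuous (fun w : 'M[R]_(k, l) => w^T).
  move=> w B /nbhs_ballP [e /= e0 eB]; apply/nbhs_ballP; exists e => //= z [_ wz].
  by apply: eB; split=> // i j; rewrite !mxE; exact: wz.
have -> : K = (fun w : 'rV[R]_n => w^T) @`
    ([set w : 'rV[R]_n | forall i, I i (w ord0 i)] `&` (fun w : 'rV[R]_n => w^T) @^-1` K).
  apply/seteqP; split=> [v Kv|_ [w [_ Kw] <-] //].
  exists v^T; last by rewrite trmxK.
  split; last by rewrite /preimage /= trmxK.
  move=> i; rewrite /I /= in_itv /= !mxE.
  have := le_trans (coord_sqr_le _ i) Kv; rewrite !mxE.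
  set d := v i ord0; set e := c i ord0 => h.
  have := sqr_ge0 (d - e); have := sqr_ge0 (d - e - 1); have := sqr_ge0 (d - e + 1).
  by move=> *; apply/andP; split; lra.
apply: continuous_compact; first by apply: continuous_subspaceT; exact: tr_cont.
apply: compact_closedI => //; apply: closed_comp; first by move=> w _; exact: tr_cont.
apply: (@closed_comp _ _ (fun v : 'cV[R]_n => dotv (v - c) (v - c)) [set t | t <= M]).
  by move=> w _; exact: sqr_dist_continuous.
exact: closed_le.
Qed.

End EuclideanSpace.

Section OperatorNorm.
Variables (R : realType) (m n : nat) (A : 'M[R]_(m, n)).

Lemma dotv_trmx (v : 'cV[R]_n) (w : 'cV[R]_m) :
  dotv (A *m v) w = dotv v (A^T *m w).
Proof. by rewrite !dotvE trmx_mul mulmxA. Qed.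

Lemma opnorm_has_sup :
  has_sup [set enorm (A *m v) | v in [set v : 'cV[R]_n | enorm v <= 1]].
Proof.
split; first by exists (enorm (A *m 0)); exists 0 => //=; rewrite enorm0.
(* The squared Frobenius norm of [A]; [1 + F] dominates its root. *)
pose F := \sum_i dotv (row i A)^T (row i A)^T.
have F0 : 0 <= F by apply: sumr_ge0 => i _; exact: dotv_ge0.
exists (1 + F) => _ [v /= v1 <-]; apply: enorm_le_sqr; first by lra.
have v2 : dotv v v <= 1.
  by rewrite -sqr_enorm -(expr1n _ 2) ler_sqr ?nnegrE ?enorm_ge0.
apply: (@le_trans _ _ F); last by nra.
rewrite {1}/dotv; apply: ler_sum => i _; rewrite -expr2.
have -> : (A *m v) i ord0 = dotv (row i A)^T v.
  by rewrite !mxE; apply: eq_bigr => j _; rewrite !mxE.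
apply: le_trans (cauchy_schwarz_sqr _ _) _.
by rewrite ler_piMr // dotv_ge0.
Qed.

Lemma opnorm_ge0 : 0 <= opnorm A.
Proof.
apply: le_trans (ub_le_sup opnorm_has_sup.2 _) => /=; last first.
  by exists 0 => //=; rewrite enorm0.
exact: enorm_ge0.
Qed.

Lemma opnormP (v : 'cV[R]_n) : enorm (A *m v) <= opnorm A * enorm v.
Proof.
have [v0|vn0] := eqVneq (enorm v) 0.
  have -> : v = 0 by apply: dotv_eq0; rewrite -sqr_enorm v0 expr0n.
  by rewrite mulmx0 !enorm0 mulr0.
have vp : 0 < enorm v by rewrite lt_neqAle eq_sym vn0 enorm_ge0.
rewrite -ler_pdivrMr // mulrC.
have -> : (enorm v)^-1 * enorm (A *m v) = enorm (A *m ((enorm v)^-1 *: v)).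
  by rewrite -scalemxAr enormZ ger0_norm // invr_ge0 ltW.
apply: ub_le_sup opnorm_has_sup.2 _ _; exists ((enorm v)^-1 *: v) => //=.
by rewrite enormZ ger0_norm ?mulVf // invr_ge0 ltW.
Qed.

(** With [q = A^T w], the identity [|q|^2 = <A q, w>] transfers the bound from [A] to its transpose
    after division by [|q|]. *)
Lemma opnorm_trmx_sqr (w : 'cV[R]_m) :
  dotv (A^T *m w) (A^T *m w) <= opnorm A ^+ 2 * dotv w w.
Proof.
set q := A^T *m w.
have h : enorm q ^+ 2 <= opnorm A * enorm q * enorm w.
  rewrite sqr_enorm -{1}dotv_trmx.
  apply: le_trans (ler_norm _) _; apply: le_trans (cauchy_schwarz _ _) _.
  by rewrite ler_wpM2r ?enorm_ge0 // opnormP.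
have [q0|qn0] := eqVneq (enorm q) 0.
  have -> : dotv q q = 0 by rewrite -sqr_enorm q0 expr0n.
  by apply: mulr_ge0; rewrite ?sqr_ge0 ?dotv_ge0.
have qp : 0 < enorm q by rewrite lt_neqAle eq_sym qn0 enorm_ge0.
have h2 : enorm q <= opnorm A * enorm w.
  by rewrite -(ler_pM2l qp) -expr2 mulrCA mulrA.
rewrite -!sqr_enorm -exprMn ler_sqr ?nnegrE ?enorm_ge0 //.
by rewrite mulr_ge0 ?enorm_ge0 ?opnorm_ge0.
Qed.

End OperatorNorm.

(** * Convex functions with Lipschitz gradient *)

(** The limit [t -> 0+] in algebraic form: it removes second-order errors from first-order
    inequalities. *)
Lemma le0_of_linear_bound (R : realFieldType) (a K : R) :
  (forall t, 0 < t < 1 -> a <= t * K) -> a <= 0.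
Proof.
move=> h; rewrite leNgt; apply/negP => a0.
have K0 := normr_ge0 K; have KK := ler_norm K.
have d0 : 0 < a + a + `|K| by lra.
(* At this [t], the product of [t] with the absolute value of [K] equals [a - 2 t a], which is below
   [a]. *)
have t0 : 0 < a / (a + a + `|K|) by rewrite divr_gt0.
have tE : a / (a + a + `|K|) * (a + a + `|K|) = a by rewrite divfK // gt_eqF.
have := h (a / (a + a + `|K|)); rewrite t0 ltr_pdivrMr // mul1r.
by case/(_ _)/Wrap => [|h1]; [lra | nra].
Qed.

Section SmoothConvex.
Variables (R : realType) (n : nat) (h : 'cV[R]_n -> R) (L : R).
Hypothesis h_diff : forall v, differentiable h v.
Hypothesis L_ge0 : 0 <= L.
Hypothesis h_lip : forall v w, enorm (grad h v - grad h w) <= L * enorm (v - w).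
Implicit Types v w d : 'cV[R]_n.

Lemma derive_dotv_grad v d : 'D_d h v = dotv (grad h v) d.
Proof.
rewrite deriveE // {1}(matrix_sum_delta d) raddf_sum /dotv.
apply: eq_bigr => i _; rewrite big_ord1.
transitivity (d i ord0 * 'd h v (delta_mx i ord0)).
  exact: (linearZ_LR ('d h v) (d i ord0) (delta_mx i ord0)).
by rewrite -deriveE // mxE mulrC.
Qed.

Lemma is_derive_line v d (t : R) :
  is_derive t 1 (fun t => h (v + t *: d)) (dotv (grad h (v + t *: d)) d).
Proof.
have E : (fun k : R =>
    k^-1 *: ((fun t => h (v + t *: d)) (k *: (1 : R) + t) - h (v + t *: d)))
   = (fun k => k^-1 *: (h (k *: d + (v + t *: d)) - h (v + t *: d))).
  apply/funext => k; congr (_ *: (h _ - _)).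
  by rewrite scaler1 scalerDl addrCA.
have D : derivable h (v + t *: d) d by exact: diff_derivable.
split; first by rewrite /derivable E.
by rewrite -derive_dotv_grad /derive E.
Qed.

(** The Taylor bound without integrals: the mean value theorem is applied on [[0, 1]] to [psi], the
    signed Taylor remainder minus its quadratic bound, whose derivative is nonpositive there. The
    signs [e = 1] and [e = -1] give the two halves. *)
Lemma descent_abs v d : `|h (v + d) - h v - dotv (grad h v) d| <= L / 2 * dotv d d.
Proof.
suff key (e : R)  : e ^+ 2 = 1 ->
    e * (h (v + d) - h v - dotv (grad h v) d) <= L / 2 * dotv d d.
  have := key 1; have := key (-1); rewrite sqrrN expr1n ler_norml => h1 h2.
  by have := h1 erefl; have := h2 erefl; lra.
move=> e2.
have e1 : `|e| = 1 by apply/eqP; rewrite -sqrp_eq1 // -normrX e2 normr1.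
pose phi := fun t : R => h (v + t *: d).
pose psi : R -> R := (e \*: (phi - (dotv (grad h v) d \*: @idfun R)))
   - ((L / 2 * dotv d d) \*: (@idfun R ^+ 2)).
pose dpsi (t : R) := e * (dotv (grad h (v + t *: d)) d - dotv (grad h v) d)
   - L * t * dotv d d.
have der (t : R) : is_derive t 1 psi (dpsi t).
  have dphi := is_derive_line v d t.
  apply: is_derive_eq; rewrite /dpsi /= /GRing.scale /=.
  by field.
have cont : {within `[0, 1], continuous psi}.
  apply: continuous_subspaceT => t.
  by apply: differentiable_continuous; apply/derivable1_diffP; apply: ex_derive.
have [c c01] := MVT (@ltr01 R) (fun t _ => der t) cont.
rewrite subr0 mulr1 /psi /phi /=.
rewrite !fctE /= scale0r addr0 scale1r /GRing.scale /=.
suff dc : dpsi c <= 0 by move: dc; move=> ? ?; lra.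
move: c01; rewrite in_itv /= => /andP[c0 c1].
rewrite /dpsi -dotvBl subr_le0.
apply: le_trans (ler_norm _) _; rewrite normrM e1 mul1r.
apply: le_trans (cauchy_schwarz _ _) _.
rewrite -sqr_enorm expr2 mulrA ler_wpM2r ?enorm_ge0 //.
apply: le_trans (h_lip _ _) _.
by rewrite [v + _]addrC addrK enormZ gtr0_norm // mulrA.
Qed.

Lemma descent v w : h w <= h v + dotv (grad h v) (w - v) + L / 2 * dotv (w - v) (w - v).
Proof. by have := descent_abs v (w - v); rewrite subrKC ler_norml; lra. Qed.

Hypothesis h_convex : convex_function [set: 'cV[R]_n] h.

Lemma convex_line v w (t : R) : 0 <= t <= 1 ->
  h (v + t *: (w - v)) <= h v + t * (h w - h v).
Proof.
move=> /andP[t0 t1].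
have := h_convex (Itv01 t0 t1) (mem_setT (w : convex_lmodType 'cV[R]_n))
  (mem_setT (v : convex_lmodType 'cV[R]_n)).
rewrite -[X in is_true X -> _]/(h (t *: w + (1 - t) *: v) <= t * h w + (1 - t) * h v).
have -> : v + t *: (w - v) = t *: w + (1 - t) *: v.
  by rewrite scalerBr scalerBl scale1r addrCA addrC.
by lra.
Qed.

Lemma grad_ineq v w : h v + dotv (grad h v) (w - v) <= h w.
Proof.
have := @convex_line v w; move: (w - v) => d cvx.
rewrite -subr_le0.
apply: (@le0_of_linear_bound _ _ (L / 2 * dotv d d)) => t /andP[t0 t1].
have := descent_abs v (t *: d); have := cvx t.
rewrite (ltW t0) (ltW t1) => /(_ isT).
rewrite !dotv_linE ler_norml => h1 /andP[h2 _].
rewrite -(ler_pM2l t0); lra.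
Qed.

(** The Baillon-Haddad inequality. In [half], [h] is evaluated after a gradient step from [b], at
    [b - G / L]: convexity from [a] bounds it below and the descent inequality from [b] bounds it
    above. Adding [half] to its mirror image cancels the function values. *)
Lemma cocoercive v w : dotv (grad h v - grad h w) (grad h v - grad h w) <=
  L * dotv (v - w) (grad h v - grad h w).
Proof.
have [L0|Ln0] := eqVneq L 0.
  have := h_lip v w; rewrite L0 !mul0r -sqr_enorm => h0.
  have -> : enorm (grad h v - grad h w) = 0 by apply/eqP; rewrite eq_le h0 enorm_ge0.
  by rewrite expr0n.
have Lp : 0 < L by rewrite lt_neqAle eq_sym Ln0.
have LV : L * L^-1 = 1 by rewrite divff.
have half a b : h a + dotv (grad h a) (b - a)
    + L^-1 / 2 * dotv (grad h b - grad h a) (grad h b - grad h a) <= h b.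
  set G := grad h b - grad h a.
  have := grad_ineq a (b - L^-1 *: G); have := descent b (b - L^-1 *: G).
  have -> : b - L^-1 *: G - b = - (L^-1 *: G) by rewrite addrC addKr.
  have -> : b - L^-1 *: G - a = (b - a) - L^-1 *: G by rewrite addrAC.
  have EG : dotv G G = dotv (grad h b) G - dotv (grad h a) G by rewrite -dotvBl.
  rewrite [dotv (grad h a) (b - a - _)]dotvBr !(dotvNl, dotvNr, dotvZl, dotvZr).
  have -> : L / 2 * - - (L^-1 * (L^-1 * dotv G G)) = L^-1 / 2 * dotv G G.
    by field.
  move=> h1 h2; rewrite EG in h1 *; lra.
have := half v w; have := half w v.
have -> : dotv (grad h w) (v - w) = - dotv (grad h w) (w - v).
  by rewrite -dotvNr opprB.
have -> : dotv (grad h v - grad h w) (grad h v - grad h w) =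
    dotv (grad h w - grad h v) (grad h w - grad h v).
  by rewrite -opprB dotvNl dotvNr opprK.
have -> : dotv (v - w) (grad h v - grad h w) =
   dotv (grad h w) (w - v) - dotv (grad h v) (w - v).
  by rewrite -opprB dotvNl dotvBr !(dotvC (w - v)) opprB.
set q := dotv (grad h w - _) _ => h1 h2.
have : L^-1 * q <= dotv (grad h w) (w - v) - dotv (grad h v) (w - v) by lra.
by rewrite -(ler_pM2l Lp) mulrA LV mul1r.
Qed.

(** The gradient step is explicit: the gradient is taken at [v] but tested against the later point
    [p]. Cocoercivity yields [|G|^2 / L], and completing the square in [|G|^2 / L + <d, G>] leaves
    [- (L / 4) |d|^2]. Doubled, this is the loss [L / 2] that the condition [t * L < 2]
    compensates. *)
Lemma grad_mono_shift v w p q :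
  - (L / 4) * dotv ((p - v) - (q - w)) ((p - v) - (q - w))
  <= dotv (p - q) (grad h v - grad h w).
Proof.
have -> : p - q = (v - w) + ((p - v) - (q - w)).
  by apply/matrixP => i j; rewrite !mxE; ring.
have := cocoercive v w.
set G := grad h v - grad h w; set d := p - v - _; set e := v - w.
rewrite dotvDl => c; clearbody G d e.
have [L0|Ln0] := eqVneq L 0.
  have G0 : G = 0.
    by apply: dotv_eq0; apply/eqP; rewrite eq_le dotv_ge0 andbT (le_trans c) // L0 mul0r.
  by rewrite G0 !dotv0r L0 !mul0r oppr0 mul0r addr0.
have Lp : 0 < L by rewrite lt_neqAle eq_sym Ln0.
have := dotv_ge0 (G + (L / 2) *: d); rewrite !dotv_linE (dotvC d G) => y.
rewrite -(ler_pM2l Lp); lra.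
Qed.

End SmoothConvex.

(** * Subgradients, proximal points, projections *)

Section Subgradients.
Variables (R : realType) (n : nat).
Implicit Types (h : 'cV[R]_n -> \bar R) (u v w p q : 'cV[R]_n).

Definition subgradient h p w : Prop := edom h p /\
  forall u, edom h u -> fine (h p) + dotv w (u - p) <= fine (h u).

Lemma edom_fineK h u : eproper h -> edom h u -> h u = (fine (h u))%:E.
Proof.
by move=> [hN _]; rewrite /edom /=; move: (hN u); case: (h u).
Qed.

Lemma fineK_edom h u (c : R) : (h u <= c%:E)%E -> edom h u.
Proof. by move=> le; apply: le_lt_trans le _; rewrite ltry. Qed.

Lemma econvex_fine h u v (t : R) : eproper h -> econvex h ->
  edom h u -> edom h v -> 0 < t < 1 ->
  edom h (u + t *: (v - u)) /\
  fine (h (u + t *: (v - u))) <= fine (h u) + t * (fine (h v) - fine (h u)).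
Proof.
move=> ph ch hu hv t01.
have E : u + t *: (v - u) = (1 - t) *: u + t *: v.
  by apply/matrixP => i j; rewrite !mxE; ring.
have := ch u v t t01; rewrite -E (edom_fineK ph hu) (edom_fineK ph hv).
rewrite -!EFinM -EFinD => le; have d := fineK_edom le; split => //.
by move: le; rewrite (edom_fineK ph d) lee_fin /=; lra.
Qed.

(** Minimality of [h] plus a smooth term gives the subgradient inequality only up to a quadratic
    error. Moving from [p] towards [u] by a fraction [t] makes this error of order [t ^+ 2], while
    convexity keeps the rest linear in [t]. *)
Lemma subgradient_quadratic h p w (K : R) : eproper h -> econvex h ->
  edom h p ->
  (forall u, edom h u ->
     fine (h p) + dotv w (u - p) <= fine (h u) + K * dotv (u - p) (u - p)) ->
  subgradient h p w.
Proof.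
move=> ph ch hp quad; split=> // u hu.
rewrite -subr_le0; apply: (@le0_of_linear_bound _ _ (K * dotv (u - p) (u - p))) => t t01.
have [d le] := econvex_fine ph ch hp hu t01.
have := quad _ d; have -> : p + t *: (u - p) - p = t *: (u - p) by rewrite addrC addKr.
move: (u - p) le => e le; rewrite !dotv_linE => q.
move/andP: t01 => [t0 _]; rewrite -(ler_pM2l t0); lra.
Qed.

Lemma prox_subgradient h v p (c : R) : eproper h -> econvex h -> 0 < c ->
  prox (fun u => c%:E * h u)%E v p -> subgradient h p (c^-1 *: (v - p)).
Proof.
move=> ph ch c0 pp.
have real u : edom h u -> ((c%:E * h p) + (2^-1 * enorm (p - v) ^+ 2)%:E <=
    (c * fine (h u) + 2^-1 * enorm (u - v) ^+ 2)%:E)%E.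
  by move=> hu; have := pp u; rewrite (edom_fineK ph hu).
have hp : edom h p.
  have [hN [u hu]] := ph; have := real u hu; rewrite /edom /=.
  move: (hN p); case: (h p) => [s|_|] //; first by rewrite ltry.
  by rewrite gt0_muley ?lte_fin.
apply: (@subgradient_quadratic _ _ _ (c^-1 * 2^-1)) => // u hu.
have := real u hu; rewrite (edom_fineK ph hp) -EFinM -EFinD lee_fin /= !sqr_enorm.
have -> : u - v = (u - p) + (p - v) by rewrite subrKA.
have -> : v - p = - (p - v) by rewrite opprB.
move: (u - p) (p - v) => d e; rewrite !dotv_linE (dotvC d e) => le.
rewrite -(ler_pM2l c0).
have -> : c * (fine (h p) + c^-1 * - dotv e d) = c * fine (h p) - dotv e d.
  by field; rewrite gt_eqF.
have -> : c * (fine (h u) + c^-1 / 2 * dotv d d) = c * fine (h u) + dotv d d / 2.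
  by field; rewrite gt_eqF.
by lra.
Qed.

Lemma subgradient_mono h p q v w : subgradient h p v -> subgradient h q w ->
  0 <= dotv (p - q) (v - w).
Proof.
move=> [hp sp] [hq sq]; have := sp _ hq; have := sq _ hp.
rewrite -(opprB p q); move: (p - q) => d; rewrite !dotv_linE !(dotvC d); lra.
Qed.

End Subgradients.

Section Minimizers.

Lemma seq_min (R : realDomainType) (s : seq R) : s != [::] ->
  exists2 a, a \in s & forall b, b \in s -> a <= b.
Proof.
elim: s => [/eqP //|a [|b s] IH _].
  by exists a; rewrite ?mem_head // => b; rewrite inE => /eqP ->.
have [c cs cm] := IH isT.
have [ac|ca] := lerP a c.
  exists a; rewrite ?mem_head // => d; rewrite inE => /orP[/eqP -> //|/cm].
  exact: le_trans.
exists c; first by rewrite inE cs orbT.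
by move=> d; rewrite inE => /orP[/eqP -> |/cm //]; exact: ltW.
Qed.

(** If no minimum were attained, the open sets where [F] exceeds [a], for [a] above some value of
    [F] on [K], would cover [K]. The smallest index of a finite subcover bounds some [F u] from
    above, but [u] itself needs a smaller index. *)
Lemma lsc_compact_min (R : realType) (T : ptopologicalType) (F : T -> \bar R)
    (K : set T) : compact K -> K !=set0 -> lower_semicontinuous F ->
  (forall u, F u != -oo%E) ->
  exists2 p, K p & forall u, K u -> (F p <= F u)%E.
Proof.
move=> cK [k0 Kk0] lsc FN; apply: contrapT => nomin.
have {}nomin p : K p -> exists2 u, K u & (F u < F p)%E.
  move=> Kp; apply: contrapT => h; apply: nomin; exists p => // u Ku.
  by rewrite leNgt; apply/negP => lt; apply: h; exists u.
move: cK; rewrite compact_cover => cK.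
have [||D' sD cov] := cK R [set a | exists2 u, K u & (F u <= a%:E)%E]
    (fun a => [set y | (a%:E < F y)%E]).
- by move=> a _; move/lower_semicontinuousP: lsc; exact.
- move=> y Ky; have [u Ku lt] := nomin y Ky.
  have fu : F u = (fine (F u))%:E.
    by move: (FN u) lt; case: (F u) => // _; rewrite ltNge leey.
  by exists (fine (F u)); [exists u => //; rewrite -fu | rewrite /= -fu].
have {}cov y : K y -> exists2 b, b \in finmap.enum_fset D' & (b%:E < F y)%E.
  by move=> /cov [b bD bF]; exists b.
have [|a aD amin] := @seq_min R (finmap.enum_fset D').
  by apply/eqP => D0; have [b] := cov _ Kk0; rewrite D0.
have := sD _ aD; rewrite inE => -[u Ku ua].
have [b bD bu] := cov _ Ku.
by have := lt_le_trans bu ua; rewrite lte_fin ltNge amin.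
Qed.

Lemma lscD_continuous (R : realType) (T : topologicalType) (h : T -> \bar R)
    (phi : T -> R) : lower_semicontinuous h -> (forall u, h u != -oo%E) ->
  continuous phi -> lower_semicontinuous (fun u => h u + (phi u)%:E)%E.
Proof.
move=> lsc hN cphi v a av.
have [b ab bh] : exists2 b : R, a - phi v < b & (b%:E < h v)%E.
  move: av (hN v); case: (h v) => [s||] // av _.
    exists ((a - phi v + s) / 2); move: av; rewrite -EFinD !lte_fin; lra.
  by exists (a - phi v + 1); [rewrite ltrDl | rewrite ltry].
have [V nV Vh] := lsc v b bh.
exists (V `&` [set y | a - b < phi y]).
  apply: filterI => //.
  by apply: (cphi v [set t | a - b < t]); apply: lt_nbhsr; lra.
move=> y [/Vh by_ /= py]; rewrite -lteBlDr //; apply: le_lt_trans by_.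
by rewrite -EFinB lee_fin; lra.
Qed.

End Minimizers.

Section LipschitzDomain.
Variables (R : realType) (n : nat) (h : 'cV[R]_n -> \bar R).
Hypotheses (ph : eproper h) (lsch : lower_semicontinuous h)
  (liph : lipschitz_on_edom h).
Implicit Types u v c p : 'cV[R]_n.

Lemma lipschitz_on_edom_ge0 : exists2 L : R, 0 <= L & forall u v,
  edom h u -> edom h v -> `|fine (h u) - fine (h v)| <= L * enorm (u - v).
Proof.
case: liph => L hL; exists `|L| => // u v hu hv.
by apply: le_trans (hL _ _ hu hv) _; rewrite ler_wpM2r ?enorm_ge0 // ler_norm.
Qed.

Lemma lipschitz_prox_exists c : exists2 p, edom h p & forall u, edom h u ->
  fine (h p) + 2^-1 * dotv (p - c) (p - c) <=
  fine (h u) + 2^-1 * dotv (u - c) (u - c).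
Proof.
have [L L0 hL] := lipschitz_on_edom_ge0.
have [hN [u0 hu0]] := ph.
pose F u := (h u + (2^-1 * dotv (u - c) (u - c))%:E)%E.
have FE u : edom h u -> F u = (fine (h u) + 2^-1 * dotv (u - c) (u - c))%:E.
  by move=> hu; rewrite /F (edom_fineK ph hu).
have lscF : lower_semicontinuous F.
  apply: lscD_continuous => // v.
  exact: (@cvgM _ _ (nbhs v)) (cvg_cst _) (@sqr_dist_continuous R n c v).
have FN u : F u != -oo%E by rewrite /F; move: (hN u); case: (h u).
(* Outside this ball the quadratic beats the affine lower bound that the
   Lipschitz condition gives. *)
pose M := 4 * (dotv (u0 - c) (u0 - c) + 4 * L ^+ 2) + dotv (u0 - c) (u0 - c).
have [|p Kp pmin] := lsc_compact_min (@eball_compact R n c M) _ lscF FN.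
  by exists u0 => /=; rewrite /M; have := dotv_ge0 (u0 - c); nra.
have in_ball u : edom h u -> (F u <= F u0)%E -> dotv (u - c) (u - c) <= M.
  move=> hu; rewrite (FE _ hu) (FE _ hu0) lee_fin.
  have := hL _ _ hu hu0; rewrite ler_norml => /andP[lo _] le.
  have tri := enorm_triangle u c u0; rewrite (enormB c) in tri.
  move: le; rewrite -!sqr_enorm /M -sqr_enorm.
  have := enorm_ge0 (u - c); have := enorm_ge0 (u0 - c).
  set a := enorm (u - c) in tri *; set b := enorm (u0 - c) in tri *.
  move=> b0 a0 le.
  have : L * enorm (u - u0) <= L * (a + b) by rewrite ler_wpM2l.
  have := sqr_ge0 (a / 2 - L); have := sqr_ge0 (b - L).
  nra.
have Fp0 : (F p <= F u0)%E.
  by apply: pmin => /=; rewrite /M; have := dotv_ge0 (u0 - c); nra.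
have hp : edom h p.
  move: Fp0; rewrite (FE _ hu0) /F /edom /=.
  by move: (hN p); case: (h p) => [s||] //; rewrite ltry.
exists p => // u hu; rewrite -lee_fin -!FE //.
have [le|lt] := leP (F u) (F u0); first by apply: pmin; exact: in_ball.
exact: le_trans Fp0 (ltW lt).
Qed.

(** The domain is closed: near a point outside it, lower semicontinuity pushes [h] above any level,
    while on the domain the Lipschitz condition keeps [h] bounded locally. Phrasing this for the
    indicator function lets [lipschitz_prox_exists] produce projections. *)
Lemma edom_closed_lsc :
  lower_semicontinuous (fun u => if `[< edom h u >] then 0%E else +oo%E : \bar R).
Proof.
have [L L0 hL] := lipschitz_on_edom_ge0.
have [hN [u0 hu0]] := ph.
move=> v a; case: asboolP => [hv|nhv] av.
  exists setT; first exact: filterT.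
  by move=> y _; case: asboolP => // _; rewrite ltry.
have hv : h v = +oo%E.
  by move: nhv; rewrite /edom /=; case: (h v) => // s; rewrite ltry => /(_ isT).
pose b := fine (h u0) + L * (enorm (v - u0) + 1).
have [V nV Vb] : exists2 V, nbhs v V & forall y, V y -> (b%:E < h y)%E.
  by apply: lsch; rewrite hv ltry.
exists (V `&` [set y | dotv (y - v) (y - v) < 1]).
  apply: filterI => //; apply: (@sqr_dist_continuous R n v v [set t | t < 1]).
  by apply: lt_nbhsl; rewrite subrr dotv0r.
move=> y [/Vb bh /= y1]; case: asboolP => [hy|_]; last by rewrite ltry.
have := hL _ _ hy hu0; rewrite ler_norml => /andP[_ up].
have y1' : enorm (y - v) <= 1 by apply: enorm_le_sqr => //; rewrite expr1n ltW.
have tri := enorm_triangle y v u0.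
move: bh; rewrite (edom_fineK ph hy) lte_fin /b => bh.
have : L * enorm (y - u0) <= L * (enorm (v - u0) + 1) by rewrite ler_wpM2l //; lra.
by move=> ?; exfalso; lra.
Qed.

End LipschitzDomain.

(** The projection is a proximal point of the indicator [i] of the domain, and [i] is Lipschitz on
    its domain with constant 0. *)
Lemma proj_on_edomP (R : realType) (n : nat) (h : 'cV[R]_n -> \bar R) c :
  eproper h -> lower_semicontinuous h -> lipschitz_on_edom h ->
  edom h (proj_on (edom h) c) /\
  forall w, edom h w -> enorm (c - proj_on (edom h) c) <= enorm (c - w).
Proof.
move=> ph lsch liph.
pose i u : \bar R := if `[< edom h u >] then 0%E else +oo%E.
have iE u : edom i u <-> edom h u.
  by rewrite /edom /= /i; case: asboolP => hu; split => // _; rewrite ltry.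
have i0 u : edom h u -> i u = 0%E by rewrite /i; case: asboolP.
have pi : eproper i.
  split; first by move=> u; rewrite /i; case: asboolP.
  by have [_ [u hu]] := ph; exists u; apply/iE.
have lipi : lipschitz_on_edom i.
  by exists 0 => u v /iE hu /iE hv; rewrite !i0 // subrr normr0 mul0r.
have [p /iE hp pmin] := lipschitz_prox_exists pi (edom_closed_lsc ph lsch liph) lipi c.
apply: (@getPex _ [set p | edom h p /\ forall w, edom h w ->
  enorm (c - p) <= enorm (c - w)]).
exists p; split => // w hw.
apply: enorm_le_sqr; rewrite ?enorm_ge0 // sqr_enorm.
have wi : edom i w by apply/iE.
have := pmin w wi; rewrite !i0 //.
rewrite -(opprB c p) -(opprB c w) !(dotvNl, dotvNr) !opprK /=; lra.
Qed.

(** * Conjugates and saddle points *)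

Section Conjugate.
Variables (R : realType) (m : nat) (g : 'cV[R]_m -> \bar R).
Hypothesis pg : eproper g.
Implicit Types u v y q : 'cV[R]_m.

Lemma conj_ge u y : edom g u ->
  ((dotv u y - fine (g u))%:E <= fenchel_conj g y)%E.
Proof.
move=> gu; apply: ereal_sup_ubound; exists u => //.
by rewrite EFinB -(edom_fineK pg gu).
Qed.

Lemma conj_le y (c : \bar R) :
  (forall u, edom g u -> ((dotv u y - fine (g u))%:E <= c)%E) ->
  (fenchel_conj g y <= c)%E.
Proof.
move=> le; apply: ge_ereal_sup => _ [u _ <-].
have [gu|ngu] := pselect (edom g u).
  by have := le u gu; rewrite EFinB -(edom_fineK pg gu).
have -> : g u = +oo%E; last by rewrite leNye.
by move: ngu; rewrite /edom /=; case: (g u) => [s|//|]; rewrite ?ltry ?ltNye.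
Qed.

Lemma conj_neqNy y : fenchel_conj g y != -oo%E.
Proof.
have [_ [u gu]] := pg; have := conj_ge y gu.
by case: (fenchel_conj g y).
Qed.

Lemma conj_convex : econvex (fenchel_conj g).
Proof.
move=> y z t /andP[t0 t1]; apply: conj_le => u gu.
have := conj_ge y gu; have := conj_ge z gu.
move: (conj_neqNy y) (conj_neqNy z).
case: (fenchel_conj g y) (fenchel_conj g z) => [a||] [b||] // _ _.
- rewrite !lee_fin !dotvDr !dotvZr => hb ha.
  rewrite -[X in (X <= _)%R]/(_ - _).
  have : t * (dotv u z - fine (g u)) <= t * b by rewrite ler_pM2l.
  have : (1 - t) * (dotv u y - fine (g u)) <= (1 - t) * a by rewrite ler_pM2l ?subr_gt0.
  by lra.
- by move=> _ _; rewrite gt0_muley ?lte_fin // -EFinM addey // leey.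
- by move=> _ _; rewrite gt0_muley ?lte_fin ?subr_gt0 // -EFinM addye // leey.
- by move=> _ _; rewrite !gt0_muley ?lte_fin ?subr_gt0 // leey.
Qed.

Lemma young_fenchel u y : edom g u -> edom (fenchel_conj g) y ->
  dotv u y <= fine (g u) + fine (fenchel_conj g y).
Proof.
move=> gu gy; have := conj_ge y gu; move: (conj_neqNy y) gy; rewrite /edom /=.
by case: (fenchel_conj g y) => [s||] //=; rewrite lee_fin; lra.
Qed.

Hypotheses (cg : econvex g) (lscg : lower_semicontinuous g)
  (lipg : lipschitz_on_edom g).

(* The proximal point of [g] at [v + q] gives a pair [(p, v + q - p)] in the
   graph of the subdifferential of [g]; monotonicity of the subdifferential of
   the conjugate then forces [p = v].  This replaces the biconjugate theorem. *)
Lemma conj_subgradient_eq q v : subgradient (fenchel_conj g) q v ->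
  edom g v /\ fine (g v) + fine (fenchel_conj g q) = dotv v q.
Proof.
move=> sv; have [p gp pmin] := lipschitz_prox_exists pg lscg lipg (v + q).
pose q' := v + q - p.
have [_ sp] : subgradient g p q'.
  apply: (@subgradient_quadratic _ _ _ _ _ 2^-1) => // u gu.
  have := pmin _ gu.
  have -> : u - (v + q) = (u - p) + (p - (v + q)) by rewrite subrKA.
  have -> : q' = - (p - (v + q)) by rewrite opprB.
  move: (u - p) (p - _) => d e; rewrite !dotv_linE (dotvC d e); lra.
have le_q' : (fenchel_conj g q' <= (dotv p q' - fine (g p))%:E)%E.
  apply: conj_le => u gu; rewrite lee_fin.
  by have := sp _ gu; rewrite dotvBr !(dotvC q'); lra.
have gq' := fineK_edom le_q'.
have Eq' : fine (fenchel_conj g q') = dotv p q' - fine (g p).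
  have := conj_ge q' gp; move: le_q' (conj_neqNy q').
  by case: (fenchel_conj g q') => // s; rewrite !lee_fin /=; lra.
have sq' : subgradient (fenchel_conj g) q' p.
  split=> // y gy; rewrite Eq' dotvBr.
  by have := young_fenchel gp gy; lra.
have := subgradient_mono sv sq'.
have -> : v - p = - (q - q') by apply/matrixP => i j; rewrite !mxE; ring.
rewrite dotvNr oppr_ge0 => le0.
have qq' : q = q'.
  by apply/eqP; rewrite -subr_eq0; apply/eqP/dotv_eq0/eqP; rewrite eq_le le0 dotv_ge0.
have pv : p = v.
  by apply: (@addIr _ q); rewrite {1}qq' /q' addrC subrK.
by rewrite -pv; split => //; rewrite qq' Eq'; lra.
Qed.

End Conjugate.

Section SaddlePoint.
Variables (R : realType) (m n : nat) (A : 'M[R]_(m, n)).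
Variables (f : 'cV[R]_n -> \bar R) (f2 : 'cV[R]_n -> R) (g : 'cV[R]_m -> \bar R).
Hypotheses (pf : eproper f) (cf : econvex f) (pg : eproper g).
Variables (xs : 'cV[R]_n) (ys : 'cV[R]_m).
Hypothesis saddle : saddle_point A f f2 g xs ys.

Lemma saddle_conj_proper : eproper (fenchel_conj g).
Proof.
by case: saddle => _ gs _; split; [exact: conj_neqNy | exists ys].
Qed.

Lemma saddle_dual : subgradient (fenchel_conj g) ys (A *m xs).
Proof.
case: saddle => fs gs sad; split => // y gy.
have [le _] := sad xs y; move: le; rewrite /lagrangian.
have pc := saddle_conj_proper.
rewrite (edom_fineK pf fs) (edom_fineK pc gs) (edom_fineK pc gy).
by rewrite -!EFinB -?EFinD lee_fin /= dotvBr; lra.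
Qed.

Lemma saddle_primal (L : R) : (forall v, differentiable f2 v) ->
  (forall v w, enorm (grad f2 v - grad f2 w) <= L * enorm (v - w)) ->
  subgradient f xs (- grad f2 xs - A^T *m ys).
Proof.
move=> df2 lip2; case: saddle => fs gs sad.
apply: (@subgradient_quadratic _ _ _ _ _ (L / 2)) => // x fx.
have [_ le] := sad x ys; move: le; rewrite /lagrangian.
rewrite (edom_fineK pf fs) (edom_fineK pf fx) (edom_fineK saddle_conj_proper gs).
rewrite -!EFinB -?EFinD lee_fin /= !dotv_trmx.
have := descent df2 lip2 xs x; set K := _ / _ * _.
rewrite !(dotvBl, dotvBr, dotvNl) !(dotvC (A^T *m ys)); lra.
Qed.

End SaddlePoint.

(** * One step of the algorithm *)

Section StepAlgebra.
Variables (R : realType) (m n : nat).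
Implicit Types (u v X P W V D e a B : 'cV[R]_n) (Y Q b : 'cV[R]_m).

Lemma sqnormV_ge0 (t s : R) X Y : 0 < t -> 0 < s -> 0 <= sqnormV t s X Y.
Proof. by move=> t0 s0; rewrite addr_ge0 // mulr_ge0 ?sqr_ge0 // invr_ge0 ltW. Qed.

(** Every letter is a difference between two steps of equal sizes: [X], [Y] of the starting points,
    [P], [Q] of the proximal points, [D] of the gradients, [W] and [V] of the images of [Y] and [Q]
    under [A^T]. The first two inequalities are monotonicity of the subdifferentials and the third
    is [grad_mono_shift]; twice their sum is the claim with the squares expanded. *)
Lemma descent_algebra (t s L : R) X P W V D Y Q : 0 < t ->
  0 <= dotv P (t^-1 *: (X - P) - D - W) ->
  0 <= dotv Q (s^-1 *: (Y - Q)) + dotv P V ->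
  - (L / 4) * dotv (P - X) (P - X) <= dotv P D ->
  sqnormV t s (P - t *: (V - W)) Q + (t^-1 - L / 2) * dotv (P - X) (P - X)
    + (s^-1 * dotv (Q - Y) (Q - Y) - t * dotv (V - W) (V - W))
  <= sqnormV t s X Y.
Proof.
move=> t0; have : t^-1 * t = 1 by rewrite mulVf // gt_eqF.
rewrite /sqnormV !sqr_enorm.
have [Z ->] : exists Z, V = Z + W by exists (V - W); rewrite subrK.
rewrite addrK.
move: (t^-1) (s^-1) => it si tt.
rewrite !dotv_linE (dotvC Z P) (dotvC X P) (dotvC Y Q) => h1 h2 h3.
have : it * t * dotv P Z = dotv P Z by rewrite tt mul1r.
have : it * t * (t * dotv Z Z) = t * dotv Z Z by rewrite tt mul1r.
by lra.
Qed.

(** Young's inequality with weight 6: a cross term costs a sixth of the new squared quantity, and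
    [z ^+ 2 <= r * c * t] turns the change of step sizes into the single factor [r] on the old
    one. *)
Lemma young_ratio k (c t z r : R) (u v : 'cV[R]_k) : 0 < c -> z ^+ 2 <= r * c * t ->
  2 * (z * dotv u v) <= 6^-1 * (c * dotv u u) + 6 * r * (t * dotv v v).
Proof.
move=> c0 zc; rewrite -(ler_pM2l c0).
have : z ^+ 2 * dotv v v <= r * c * t * dotv v v by rewrite ler_wpM2r ?dotv_ge0.
have := dotv_ge0 (c *: u - (6 * z) *: v); rewrite !dotv_linE (dotvC v u); lra.
Qed.

(* Residuals of two consecutive steps, of sizes [(t, s)] and then [(t', s')]:
   [a], [b] are the increments of [x], [y] in the first step, [b'] that of [y]
   in the second one, [e'] is the new [xbar] minus the current [x], [B] and [B']
   are the images of [b] and [b'] under [A^T], [D] is the increment of the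
   gradient and [K] is the squared norm of [A]. *)
Lemma step_change_algebra (t s t' s' r K L : R) a B D b e' B' b' :
  0 < t -> 0 < s -> 0 < t' -> 0 < s' -> 1 < r -> 0 <= L ->
  t <= r * t' -> t' <= r * t -> s' <= r * s ->
  s * t * K < 1 -> s' * t' * K < 1 -> t * L < 2 ->
  dotv B B <= K * dotv b b -> dotv B' B' <= K * dotv b' b' ->
  dotv D D <= L ^+ 2 * dotv a a ->
  0 <= dotv (e' - t *: B) (t^-1 *: a - t'^-1 *: e' - D) ->
  0 <= dotv b' (s^-1 *: b - s'^-1 *: b') + dotv (e' - t *: B) B' ->
  sqnormV t' s' (e' - t' *: B') b' <= 216 * r * sqnormV t s a b.
Proof.
move=> t0 s0 t'0 s'0 r1 L0 tr t'r s'r tsK tsK' tL hB hB' hD mono_f mono_k.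
have it0 : 0 < t^-1 by rewrite invr_gt0.
have it'0 : 0 < t'^-1 by rewrite invr_gt0.
have si0 : 0 < s^-1 by rewrite invr_gt0.
have si'0 : 0 < s'^-1 by rewrite invr_gt0.
have tt : t^-1 * t = 1 by rewrite mulVf // gt_eqF.
have tt' : t'^-1 * t' = 1 by rewrite mulVf // gt_eqF.
have ss : s^-1 * s = 1 by rewrite mulVf // gt_eqF.
have ss' : s'^-1 * s' = 1 by rewrite mulVf // gt_eqF.
have bound c d w z : 0 < c -> 0 < d -> d^-1 * d = 1 -> d * c * K < 1 ->
    dotv w w <= K * dotv z z -> c * dotv w w <= d^-1 * dotv z z.
  move=> c0 d0 dd dcK hw; rewrite -(ler_pM2l d0) mulrA [leRHS]mulrA.
  rewrite [d * _^-1]mulrC dd mul1r.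
  apply: (@le_trans _ _ (d * c * (K * dotv z z))); first by rewrite ler_pM2l ?mulr_gt0.
  by rewrite mulrA ler_piMl ?dotv_ge0 // ltW.
have hB1 := bound _ _ t s B b t0 s0 ss tsK hB.
have hB1' := bound _ _ t' s' B' b' t'0 s'0 ss' tsK' hB'.
have hD1 : t * dotv D D <= 4 * (t^-1 * dotv a a).
  apply: (@le_trans _ _ (t * (L ^+ 2 * dotv a a))); first by rewrite ler_pM2l.
  rewrite !mulrA ler_wpM2r ?dotv_ge0 // -(ler_pM2l t0) [leRHS]mulrCA divff ?gt_eqF //.
  have : 0 <= t * L by rewrite mulr_ge0 // ltW.
  nra.
have c1 : t^-1 <= r * t'^-1.
  by rewrite -(ler_pM2l t0) divff ?gt_eqF // mulrA ler_pdivlMr // mul1r mulrC.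
have c4 : s^-1 <= r * s'^-1.
  by rewrite -(ler_pM2l s0) divff ?gt_eqF // mulrA ler_pdivlMr // mul1r mulrC.
have c3 : t * t'^-1 <= r by rewrite ler_pdivrMr.
have y1 := @young_ratio n t'^-1 t^-1 t^-1 r e' a it'0 _.
have y2 := @young_ratio n t'^-1 t (-1) r e' D it'0 _.
have y3 := @young_ratio n t'^-1 t (t * t'^-1) r e' B it'0 _.
have y4 := @young_ratio m s'^-1 s^-1 s^-1 r b' b si'0 _.
have y5 := @young_ratio n t' t (- t) r B' B t'0 _.
have {}y1 := y1 ltac:(by rewrite expr2 ler_pM2r).
have {}y4 := y4 ltac:(by rewrite expr2 ler_pM2r).
have {}y2 := y2 ltac:(by rewrite sqrrN expr1n mulrAC ler_pdivlMr // mul1r).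
have {}y3 := y3 ltac:(by rewrite expr2 -[leRHS]mulrA [t'^-1 * t]mulrC ler_wpM2r //
  mulr_ge0 // ltW).
have {}y5 := y5 ltac:(by rewrite sqrrN expr2 ler_pM2r).
(* The product of [e'] and [B'] involves new quantities only. After doubling the sum of the two
   monotonicity inequalities it consumes half of the left side, since [t' |B'|^2 <= |b'|^2 / s'];
   the sixths in [y1] to [y5] take at most half of what remains. *)
have y6 := young B' e' t'0.
have y7 := young B (- a) t0.
have y8 := young B D (@ltr01 R).
have y9 := mulr_ge0 (ltW it'0) (dotv_ge0 (e' + t' *: B')).
have rB : r * (t * dotv B B) <= r * (s^-1 * dotv b b) by rewrite ler_pM2l //; lra.
have rD : r * (t * dotv D D) <= r * (4 * (t^-1 * dotv a a)) by rewrite ler_pM2l //; lra.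
have ty8 : t * (2 * dotv B D) <= t * (1 * dotv B B + 1^-1 * dotv D D) by rewrite ler_pM2l.
have a0 : 0 <= t^-1 * dotv a a by rewrite mulr_ge0 ?dotv_ge0 // ltW.
have b0 : 0 <= s^-1 * dotv b b by rewrite mulr_ge0 ?dotv_ge0 // ltW.
have ra : 0 <= (r - 1) * (t^-1 * dotv a a) by apply: mulr_ge0; rewrite // subr_ge0 ltW.
have rb : 0 <= (r - 1) * (s^-1 * dotv b b) by apply: mulr_ge0; rewrite // subr_ge0 ltW.
have e0' : 0 <= t'^-1 * dotv e' e' by rewrite mulr_ge0 ?dotv_ge0 // ltW.
have b0' : 0 <= s'^-1 * dotv b' b' by rewrite mulr_ge0 ?dotv_ge0 // ltW.
rewrite invr1 in ty8; rewrite /sqnormV !sqr_enorm.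
have E1 : t^-1 * t * dotv B a = dotv B a by rewrite tt mul1r.
have E1' : t'^-1 * t' * dotv e' B' = dotv e' B' by rewrite tt' mul1r.
have E2' : t'^-1 * t' * (t' * dotv B' B') = t' * dotv B' B' by rewrite tt' mul1r.
move: mono_f mono_k y1 y2 y3 y4 y5 y6 y7 y9 E1 E1' E2'.
rewrite !dotv_linE (dotvC B e') (dotvC B' e') (dotvC B B').
move: (t^-1) (t'^-1) (s^-1) (s'^-1) it0 it'0 si0 si'0 tt tt' ss ss' hB1 hB1' hD1
  ra rb a0 b0 e0' b0' rB rD ty8 c1 c3 c4 => it it' si si'.
clear -r1; move=> *.
(* The last factor 3, from 72 to 216, comes from [|e' - t' B'|^2 / t' <= 2 |e'|^2 / t' + 2 t'
   |B'|^2], which is [y9], and again [t' |B'|^2 <= |b'|^2 / s']. *)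
have N : it' * dotv e' e' + si' * dotv b' b' <= 72 * r * (it * dotv a a + si * dotv b b).
  lra.
lra.
Qed.


End StepAlgebra.

Section Step.
Variables (R : realType) (m n : nat) (A : 'M[R]_(m, n)).
Variables (f : 'cV[R]_n -> \bar R) (k : 'cV[R]_m -> \bar R).
Variables (G : 'cV[R]_n -> 'cV[R]_n) (L : R).
Hypothesis L_ge0 : 0 <= L.
Hypothesis G_shift : forall v w p q,
  - (L / 4) * dotv ((p - v) - (q - w)) ((p - v) - (q - w)) <= dotv (p - q) (G v - G w).
Hypothesis G_lip : forall v w, enorm (G v - G w) <= L * enorm (v - w).

(* A Tri-PD step in inclusion form; [k] stands for the conjugate of [g] and [G]
   for the gradient of [f2]. *)
Definition pd_step (t s : R) x y p q x' := [/\
  subgradient f p (t^-1 *: (x - p) - G x - A^T *m y),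
  subgradient k q (s^-1 *: (y - q) + A *m p) &
  x' = p - t *: (A^T *m (q - y))].

(** Applied to two consecutive steps this makes the residual decrease; applied to a step and the
    saddle point, a fixed point of the step, it makes the distance decrease, with a surplus. *)
Lemma pd_step_descent (t s : R) x y p q x' v w p' q' v' : 0 < t ->
  pd_step t s x y p q x' -> pd_step t s v w p' q' v' ->
  sqnormV t s (x' - v') (q - q')
    + (t^-1 - L / 2) * dotv ((p - x) - (p' - v)) ((p - x) - (p' - v))
    + (s^-1 - t * opnorm A ^+ 2) * dotv ((q - y) - (q' - w)) ((q - y) - (q' - w))
  <= sqnormV t s (x - v) (y - w).
Proof.
move=> t0 [sp sq xE] [sp' sq' vE].
have EPX : (p - p') - (x - v) = (p - x) - (p' - v).
  by apply/matrixP => i j; rewrite !mxE; ring.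
have EQY : (q - q') - (y - w) = (q - y) - (q' - w).
  by apply/matrixP => i j; rewrite !mxE; ring.
have := @descent_algebra R m n t s L (x - v) (p - p') (A^T *m (y - w)) (A^T *m (q - q'))
  (G x - G v) (y - w) (q - q') t0.
rewrite EPX -mulmxBr EQY.
have -> : p - p' - t *: (A^T *m (q - y - (q' - w))) = x' - v'.
  by rewrite xE vE mulmxBr scalerBr; apply/matrixP => i j; rewrite !mxE; ring.
move=> /(_ _ _ _)/Wrap; case.
- have := subgradient_mono sp sp'; congr (0 <= dotv _ _).
  by rewrite mulmxBr !scalerBr; apply/matrixP => i j; rewrite !mxE; ring.
- have := subgradient_mono sq sq'.
  rewrite -dotv_trmx (dotvC (A *m _)) -dotvDr; congr (0 <= dotv _ _).
  by rewrite mulmxBr !scalerBr; apply/matrixP => i j; rewrite !mxE; ring.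
- exact: G_shift.
have := opnorm_trmx_sqr A (q - y - (q' - w)); move: (dotv _ _) => Z hZ.
have : t * Z <= t * (opnorm A ^+ 2 * dotv (q - y - (q' - w)) (q - y - (q' - w))).
  by rewrite ler_pM2l.
by lra.
Qed.

Lemma pd_step_nonexpansive (t s : R) x y p q x' v w p' q' v' :
  0 < t -> 0 < s -> s * t * opnorm A ^+ 2 < 1 -> t * L < 2 ->
  pd_step t s x y p q x' -> pd_step t s v w p' q' v' ->
  sqnormV t s (x' - v') (q - q') <= sqnormV t s (x - v) (y - w).
Proof.
move=> t0 s0 stA tL st1 st2; apply: le_trans (pd_step_descent t0 st1 st2).
rewrite -addrA lerDl addr_ge0 // mulr_ge0 ?dotv_ge0 // subr_ge0.
  by rewrite -[t^-1]mul1r ler_pdivlMr //; lra.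
by rewrite -[s^-1]mul1r ler_pdivlMr //; lra.
Qed.

(** The descent surplus controls [p - x], whereas the residual contains [x' - x]. They differ by
    [t *: B], which the condition on [s * t] bounds by the dual increment. *)
Lemma pd_step_residual (t s : R) x y p q x' :
  0 < t -> 0 < s -> s * t * opnorm A ^+ 2 < 1 ->
  pd_step t s x y p q x' ->
  t^-1 * dotv (p - x) (p - x) <= 2 * sqnormV t s (x' - x) (q - y) /\
  sqnormV t s (x' - x) (q - y) <=
    2 * (t^-1 * dotv (p - x) (p - x)) + 3 * (s^-1 * dotv (q - y) (q - y)).
Proof.
move=> t0 s0 stA [_ _ xE].
have := opnorm_trmx_sqr A (q - y); move: xE; set B := A^T *m _ => xE hB.
have tB : t * dotv B B <= s^-1 * dotv (q - y) (q - y).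
  apply: (@le_trans _ _ (t * (opnorm A ^+ 2 * dotv (q - y) (q - y)))).
    by rewrite ler_pM2l.
  rewrite mulrA ler_wpM2r ?dotv_ge0 // -[s^-1]mul1r ler_pdivlMr //; lra.
have Exx : x' - x = (p - x) - t *: B by rewrite xE addrAC.
have tt : t^-1 * t = 1 by rewrite mulVf // gt_eqF.
rewrite /sqnormV !sqr_enorm {}Exx; clearbody B.
move: (p - x) (q - y) tB => e b; have it0 : 0 < t^-1 by rewrite invr_gt0.
move: (t^-1) (s^-1) tt it0 => it si tt it0 tB.
have y1 := mulr_ge0 (ltW it0) (dotv_ge0 (e - (2 * t) *: B)).
have y2 := mulr_ge0 (ltW it0) (dotv_ge0 (e + t *: B)).
have E1 : it * t * dotv e B = dotv e B by rewrite tt mul1r.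
have E2 : it * t * (t * dotv B B) = t * dotv B B by rewrite tt mul1r.
move: y1 y2; rewrite !dotv_linE (dotvC B e) => y1 y2; split; lra.
Qed.

(** The weights 2 and 3 on [theta] are those of the upper bound in [pd_step_residual]: each half of
    the surplus must cover its share of the residual. *)
Lemma pd_step_fejer (t s theta : R) x y p q x' v w :
  0 < t -> 0 < s -> s * t * opnorm A ^+ 2 < 1 -> 0 <= theta ->
  2 * theta <= 1 - t * L / 2 -> 3 * theta <= 1 - s * t * opnorm A ^+ 2 ->
  pd_step t s x y p q x' -> pd_step t s v w v w v ->
  sqnormV t s (x' - v) (q - w) + theta * sqnormV t s (x' - x) (q - y)
  <= sqnormV t s (x - v) (y - w).
Proof.
move=> t0 s0 stA th0 th1 th2 st1 st2; apply: le_trans (pd_step_descent t0 st1 st2).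
have [_ res] := pd_step_residual t0 s0 stA st1.
rewrite -[leRHS]addrA lerD2l !subrr !subr0.
apply: le_trans (ler_wpM2l th0 res) _; rewrite mulrDr; apply: lerD.
  rewrite !mulrA ler_wpM2r ?dotv_ge0 //.
  by rewrite ler_pdivrMr // mulrBl mulVf ?gt_eqF //; lra.
rewrite !mulrA ler_wpM2r ?dotv_ge0 //.
by rewrite ler_pdivrMr // mulrBl mulVf ?gt_eqF //; lra.
Qed.

Lemma pd_step_change (t s t' s' r : R) x y p q x' p' q' x'' :
  0 < t -> 0 < s -> 0 < t' -> 0 < s' -> 1 < r ->
  t <= r * t' -> t' <= r * t -> s' <= r * s ->
  s * t * opnorm A ^+ 2 < 1 -> s' * t' * opnorm A ^+ 2 < 1 -> t * L < 2 ->
  pd_step t s x y p q x' -> pd_step t' s' x' q p' q' x'' ->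
  sqnormV t' s' (x'' - x') (q' - q) <= 216 * r * sqnormV t s (x' - x) (q - y).
Proof.
move=> t0 s0 t'0 s'0 r1 tr t'r s'r stA stA' tL [sp sq xE] [sp' sq' xE'].
have -> : x'' - x' = (p' - x') - t' *: (A^T *m (q' - q)) by rewrite xE' addrAC.
have pE : p = x' + t *: (A^T *m (q - y)) by rewrite xE subrK.
have tt : t^-1 * t = 1 by rewrite mulVf // gt_eqF.
apply: (@step_change_algebra _ _ _ t s t' s' r (opnorm A ^+ 2) L (x' - x)
  (A^T *m (q - y)) (G x' - G x)) => //; try exact: opnorm_trmx_sqr.
- rewrite -!sqr_enorm -exprMn ler_sqr ?nnegrE ?enorm_ge0 //.
  by rewrite mulr_ge0 ?enorm_ge0.
- have E : t^-1 *: (x - p) = - (t^-1 *: (x' - x)) - A^T *m (q - y).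
    have -> : x - p = - (x' - x) - t *: (A^T *m (q - y)).
      by rewrite pE; apply/matrixP => i j; rewrite !mxE; ring.
    by rewrite scalerBr scalerN scalerA tt scale1r.
  have := subgradient_mono sp' sp; rewrite {}E {1}pE; congr (0 <= dotv _ _).
    by rewrite opprD addrA.
  rewrite -(opprB p' x') scalerN mulmxBr.
  by apply/matrixP => i j; rewrite !mxE; ring.
- have := subgradient_mono sq' sq; rewrite -(opprB q' q) -(opprB q y) !scalerN.
  have -> : p' - x' - t *: (A^T *m (q - y)) = p' - p by rewrite pE opprD addrA.
  rewrite -dotv_trmx (dotvC (A *m _)) -dotvDr; congr (0 <= dotv _ _).
  by rewrite mulmxBr; apply/matrixP => i j; rewrite !mxE; ring.
Qed.

End Step.

(** * Phases between updates *)

Section Phases.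
Variables (R : realType) (N : option nat) (s : nat -> nat).
(** These become the squared residual between iterates [k] and [k.+1], the squared distance of
    iterate [k] to the saddle point, both in the metric of step [k], and [1 / sigma k]. The residual
    tested at [s l.+1] is thus [rho (s l.+1).-1], the last one of phase [l]. *)
Variables (rho D is0 : nat -> R) (r delta C : R).
Hypotheses (r_gt1 : 1 < r) (delta_gt0 : 0 < delta) (delta_r : delta * r < 1).
Hypothesis C_ge1 : 1 <= C.
Hypotheses (rho_ge0 : forall k, 0 <= rho k) (D_ge0 : forall k, 0 <= D k).
Hypothesis s0 : s 0%N = 0%N.
Hypothesis s_incr : forall l, is_instant N l.+1 -> (s l < s l.+1)%N.
Hypothesis within : forall l k, is_instant N l -> (s l <= k)%N ->
  (is_instant N l.+1 -> (k.+1 < s l.+1)%N) ->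
  [/\ rho k.+1 <= rho k, D k.+1 <= D k & is0 k.+1 <= is0 k].
Hypothesis change : forall l k, is_instant N l.+1 -> s l.+1 = k.+1 ->
  [/\ rho k.+1 <= C * rho k, D k.+1 <= r * D k & is0 k.+1 <= r * is0 k].
Hypothesis decrease1 : is_instant N 1 -> rho (s 1%N).-1 <= delta * rho 0%N.
Hypothesis decrease : forall l, (0 < l)%N -> is_instant N l.+1 ->
  rho (s l.+1).-1 <= delta * rho (s l).-1.
Hypothesis last_phase : forall q, N = Some q ->
  exists2 theta, 0 < theta & forall k, (s q <= k)%N -> D k.+1 + theta * rho k <= D k.

Lemma is_instantS l : is_instant N l.+1 -> is_instant N l.
Proof. by rewrite /is_instant; case: N => // q; exact: ltnW. Qed.

Lemma rho_before_update l : is_instant N l.+1 ->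
  rho (s l.+1).-1 <= delta ^+ l.+1 * rho 0%N.
Proof.
elim: l => [|l IH] il; first by rewrite expr1; exact: decrease1.
apply: le_trans (decrease _ il) _ => //.
by rewrite exprS -mulrA ler_pM2l // IH // is_instantS.
Qed.

Lemma phase_bound l k : is_instant N l -> (s l <= k)%N ->
  (is_instant N l.+1 -> (k < s l.+1)%N) ->
  [/\ rho k <= C * (delta ^+ l * rho 0%N), D k <= r ^+ l * D 0%N &
      is0 k <= r ^+ l * is0 0%N].
Proof.
have r0 : 0 < r := lt_trans ltr01 r_gt1.
elim: l k => [|l IHl] k il.
  rewrite s0 => _; elim: k => [_|k IHk ik].
    by rewrite !expr0 !mul1r ler_peMl.
  have [h1 h2 h3] := IHk (fun i => ltnW (ik i)).
  have [g1 g2 g3] : [/\ rho k.+1 <= rho k, D k.+1 <= D k & is0 k.+1 <= is0 k].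
    by apply: within il _ ik; rewrite s0.
  by split; [exact: le_trans h1 | exact: le_trans h2 | exact: le_trans h3].
move=> /subnKC <-; elim: (k - s l.+1)%N => [|j IHj] ij.
  rewrite addn0; have sp := s_incr il; have [K sK] : exists K, s l.+1 = K.+1.
    by move: sp; case: (s l.+1) => // K _; exists K.
  have [h1 h2 h3] : [/\ rho K <= C * (delta ^+ l * rho 0%N),
      D K <= r ^+ l * D 0%N & is0 K <= r ^+ l * is0 0%N].
    by apply: IHl; [exact: is_instantS | rewrite -ltnS -sK | rewrite sK].
  rewrite sK; have [g1 g2 g3] := change il sK; split.
  - apply: le_trans g1 _; rewrite ler_pM2l ?(lt_le_trans ltr01) //.
    by have := rho_before_update il; rewrite sK.
  - by apply: le_trans g2 _; rewrite exprS -mulrA ler_pM2l.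
  - by apply: le_trans g3 _; rewrite exprS -mulrA ler_pM2l.
rewrite addnS in ij *.
have [h1 h2 h3] := IHj (fun i => ltnW (ij i)).
have [g1 g2 g3] := within il (leq_addr _ _) ij.
by split; [exact: le_trans h1 | exact: le_trans h2 | exact: le_trans h3].
Qed.

Lemma current_phase L k : N = None -> (s L <= k)%N ->
  exists2 l, (L <= l)%N & (s l <= k < s l.+1)%N.
Proof.
move=> N0; have si l : (s l < s l.+1)%N by apply: s_incr; rewrite N0.
move=> /subnKC <-; elim: (k - s L)%N => [|j [l Ll /andP[lo hi]]].
  by exists L; rewrite // addn0 leqnn si.
rewrite addnS; have [lt|ge] := ltnP (s L + j).+1 (s l.+1).
  by exists l; rewrite // lt (leq_trans lo).
by exists l.+1; [exact: leqW | rewrite ge (leq_ltn_trans hi)].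
Qed.

(** The multiplier [M] is [r ^+ l] for the current phase [l]. With infinitely many phases,
    [M * rho k] is at most [C * rho 0 * (r * delta) ^+ l]; in a last phase [M] is fixed and the
    residual decays like the inverse of the number of steps. *)
Lemma residual_beats_growth eta : 0 < eta -> exists K, forall k, (K <= k)%N ->
  exists2 M, 1 <= M & [/\ M * rho k <= eta, D k <= M * D 0%N & is0 k <= M * is0 0%N].
Proof.
move=> eta0; have r0 : 0 < r := lt_trans ltr01 r_gt1.
have pow_ge1 l : 1 <= r ^+ l by rewrite exprn_ege1 // ltW.
case E : N => [q|].
  have iq : is_instant N q by rewrite E /=.
  have niq : is_instant N q.+1 -> False by rewrite E /= ltnn.
  have [theta th0 dec] := last_phase E.
  have mono k : (s q <= k)%N -> rho k.+1 <= rho k.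
    by move=> qk; have [] := within iq qk (fun i => False_ind _ (niq i)).
  (* Since [rho] decreases, the telescoped sum of residuals is at least [J] times the latest one. *)
  have tele J : D (s q + J)%N + theta * (J%:R * rho (s q + J)%N) <= D (s q).
    elim: J => [|J IH]; first by rewrite addn0 mul0r mulr0 addr0.
    rewrite addnS; have := dec _ (leq_addr J (s q)); have := mono _ (leq_addr J (s q)).
    set p := rho _; set p' := rho _ => pp d.
    have : theta * (J.+1%:R * p) <= theta * (J.+1%:R * p').
      by rewrite ler_pM2l // ler_pM2l.
    by move: IH; rewrite -/p' -natr1; lra.
  (* After [J >= B] steps in the last phase, [r ^+ q * rho <= r ^+ q * D (s q) / (theta * J) <=
     eta]; the successor taken below keeps [J] positive. *)
  pose B := r ^+ q * D (s q) / (theta * eta).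
  have B0 : 0 <= B by rewrite divr_ge0 // mulr_ge0 ?exprn_ge0 // ltW.
  exists (s q + (Num.bound B).+1)%N => k Kk; exists (r ^+ q) => //.
  have qk : (s q <= k)%N by exact: leq_trans (leq_addr _ _) Kk.
  have [_ h2 h3] := phase_bound iq qk (fun i => False_ind _ (niq i)).
  split => //.
  have := tele (k - s q)%N; rewrite subnKC // => tk.
  have Jk : B <= (k - s q)%:R.
    apply: le_trans (ltW (archi_boundP B0)) _; rewrite ler_nat.
    by rewrite leq_subRL // (leq_trans _ Kk) // leq_add2l.
  have J0 : 0 < (k - s q)%:R :> R.
    by rewrite ltr0n subn_gt0 (leq_trans _ Kk) // -addn1 leq_add2l.
  have h4 : r ^+ q * D (s q) <= (k - s q)%:R * (theta * eta).
    by rewrite -ler_pdivrMr // mulr_gt0.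
  rewrite -(ler_pM2l J0) -(ler_pM2l th0).
  have : r ^+ q * (theta * ((k - s q)%:R * rho k)) <= r ^+ q * D (s q).
    rewrite ler_pM2l ?exprn_gt0 //; have := D_ge0 k; lra.
  by lra.
have inst l : is_instant N l by rewrite E.
pose c := r * delta.
have c01 : 0 < c < 1 by rewrite mulr_gt0 //= /c mulrC.
have [L hL] : exists L, C * rho 0%N * c ^+ L <= eta.
  have : (fun l => C * rho 0%N * c ^+ l) @ \oo --> C * rho 0%N * 0.
    apply: cvgMr; apply: cvg_expr; case/andP: c01 => ? ?.
    by rewrite ger0_norm // ltW.
  rewrite mulr0 => /cvgrPdist_lt /(_ _ eta0) [L _ hL]; exists L.
  have := hL L (leqnn L); rewrite /= sub0r normrN => h.
  by apply: ltW; apply: le_lt_trans (ler_norm _) h.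
exists (s L) => k Lk; have [l Ll /andP[lo hi]] := current_phase E Lk.
exists (r ^+ l) => //.
have [h1 h2 h3] := phase_bound (inst l) lo (fun=> hi); split => //.
apply: le_trans hL; apply: (@le_trans _ _ (C * rho 0%N * c ^+ l)).
  rewrite exprMn; apply: (@le_trans _ _ (r ^+ l * (C * (delta ^+ l * rho 0%N)))).
    by rewrite ler_pM2l ?exprn_gt0.
  by rewrite le_eqVlt; apply/orP; left; apply/eqP; ring.
apply: ler_wpM2l; first by apply: mulr_ge0 => //; exact: le_trans C_ge1.
by case/andP: c01 => ? ?; apply: ler_wiXn2l => //; exact: ltW.
Qed.

End Phases.

(** * Feasibility and optimality gaps *)

Section GapBounds.
Variables (R : realType) (m n : nat) (A : 'M[R]_(m, n)).
Variables (f : 'cV[R]_n -> \bar R) (f2 : 'cV[R]_n -> R) (g : 'cV[R]_m -> \bar R).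
Variables (Lf Lg : R).
Hypotheses (pf : eproper f) (cf : econvex f).
Hypotheses (pg : eproper g) (cg : econvex g) (lscg : lower_semicontinuous g).
Hypothesis lipg : lipschitz_on_edom g.
Hypotheses (f2_convex : convex_function [set: 'cV[R]_n] f2)
  (f2_diff : forall v, differentiable f2 v).
Hypothesis f2_lip : forall v w, enorm (grad f2 v - grad f2 w) <= Lf * enorm (v - w).
Variables (xs : 'cV[R]_n) (ys : 'cV[R]_m).
Hypothesis saddle : saddle_point A f f2 g xs ys.
Hypotheses (Lg_ge0 : 0 <= Lg) (Lg_lip : forall u v, edom g u -> edom g v ->
  `|fine (g u) - fine (g v)| <= Lg * enorm (u - v)).

Local Notation gc := (fenchel_conj g).
Local Notation step := (pd_step A f gc (grad f2)).

Lemma saddle_value : edom g (A *m xs) /\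
  fine (g (A *m xs)) + fine (gc ys) = dotv (A *m xs) ys.
Proof. by apply: conj_subgradient_eq => //; exact: (saddle_dual pf pg saddle). Qed.

Lemma saddle_pd_step (t s : R) : step t s xs ys xs ys xs.
Proof.
split.
- by rewrite subrr scaler0 sub0r; exact: (saddle_primal pf cf pg saddle f2_diff f2_lip).
- by rewrite subrr scaler0 add0r; exact: (saddle_dual pf pg saddle).
- by rewrite subrr mulmx0 scaler0 subr0.
Qed.

Lemma tri_pd_step tau sigma x xbar y k : (forall k, 0 < tau k) ->
  (forall k, 0 < sigma k) -> tri_pd A f f2 g tau sigma x xbar y ->
  step (tau k) (sigma k) (x k) (y k) (xbar k.+1) (y k.+1) (x k.+1).
Proof.
move=> tau0 sigma0 /(_ k) [px py xE]; split => //.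
- have := prox_subgradient pf cf (tau0 k) px; congr subgradient.
  rewrite !scalerBr !scalerA mulVf ?gt_eqF // !scale1r.
  by apply/matrixP => i j; rewrite !mxE; ring.
- have := prox_subgradient (saddle_conj_proper pg saddle) (conj_convex pg) (sigma0 k) py.
  congr subgradient; rewrite scalerBr scalerDr scalerA mulVf ?gt_eqF // scale1r scalerBr.
  by apply/matrixP => i j; rewrite !mxE; ring.
Qed.

Definition primal_gap (p : 'cV[R]_n) : R :=
  fine (f p) + f2 p + fine (g (proj_on (edom g) (A *m p)))
  - (fine (f xs) + f2 xs + fine (g (A *m xs))).

(** The dual inclusion puts [v = A p + (y - q) / s] in the domain of [g], with equality in
    Young-Fenchel at [q]. The lower bound on the gap uses the subgradient of [f] at [xs] and
    Young-Fenchel at [ys]; the upper bound uses the subgradient at [p], tested at [xs], and compares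
    [g] at the projection [w] with [g] at [v], at distance at most [b + b]. *)
Lemma pd_step_primal (t s : R) x y p q x' : 0 < t -> 0 < s ->
  step t s x y p q x' ->
  [/\ distance_to (edom g) (A *m p) <= enorm (s^-1 *: (y - q)),
      - (enorm ys * enorm (s^-1 *: (y - q))) <= primal_gap p &
      primal_gap p <= 2 * Lg * enorm (s^-1 *: (y - q))
        + t^-1 * dotv (x - x') (p - xs) + s^-1 * dotv (y - q) q
        + Lf / 2 * dotv (p - x) (p - x)].
Proof.
move=> t0 s0 [sp sq xE].
have [gv vq] := conj_subgradient_eq pg cg lscg lipg sq.
set v := _ + _ in gv vq; have vE : v - A *m p = s^-1 *: (y - q) by rewrite /v addrK.
set b := enorm _; have bE : enorm (A *m p - v) = b by rewrite enormB vE.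
have [gw wmin] := proj_on_edomP (A *m p) pg lscg lipg.
set w := proj_on _ _ in gw wmin; have wb : enorm (A *m p - w) <= b by rewrite -bE wmin.
have [gx xv] := saddle_value.
have [fx _] := saddle_primal pf cf pg saddle f2_diff f2_lip.
split.
- rewrite -bE; apply: ge_inf; last by exists v.
  by exists 0 => _ [z _ <-]; exact: enorm_ge0.
- have [_ sx] := saddle_primal pf cf pg saddle f2_diff f2_lip.
  have [fp _] := sp; have := sx _ fp.
  have := grad_ineq f2_diff f2_lip f2_convex xs p.
  have gcys : edom gc ys by case: saddle.
  have := young_fenchel pg gw gcys.
  have : - (enorm ys * b) <= dotv (w - A *m p) ys.
    have := cauchy_schwarz (w - A *m p) ys; rewrite enormB ler_norml => /andP[cs _].
    apply: le_trans cs; rewrite lerN2 mulrC ler_wpM2l ?enorm_ge0 //.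
  have -> : dotv (- grad f2 xs - A^T *m ys) (p - xs) = - dotv (grad f2 xs) (p - xs)
      - (dotv (A *m p) ys - dotv (A *m xs) ys).
    by rewrite dotvBl dotvNl (dotvC (A^T *m ys)) -dotv_trmx mulmxBr dotvBl.
  rewrite /primal_gap -/w (dotvBl _ w); lra.
- have [fp sf] := sp; have := sf _ fx.
  have := descent f2_diff f2_lip x p.
  have := grad_ineq f2_diff f2_lip f2_convex x xs.
  have [gcq _] := sq; have := young_fenchel pg gx gcq.
  have := Lg_lip gw gv; rewrite ler_norml => /andP[_ up].
  have wv : enorm (w - v) <= b + b.
    apply: le_trans (enorm_triangle _ (A *m p) _) _.
    by rewrite (enormB w) lerD // bE.
  have : Lg * enorm (w - v) <= Lg * (b + b) by rewrite ler_wpM2l.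
  (* The correction step replaces [p] by [x'] and, at the same time, [y] by [q], the dual point at
     which the Fenchel equality holds. *)
  have -> : t^-1 *: (x - p) - grad f2 x - A^T *m y =
      t^-1 *: (x - x') - A^T *m q - grad f2 x.
    have -> : x - x' = x - p + t *: (A^T *m (q - y)) by rewrite xE opprB addrCA addrC.
    rewrite [t^-1 *: (_ - _ + _)]scalerDr scalerA mulVf ?gt_eqF // scale1r mulmxBr.
    by apply/matrixP => i j; rewrite !mxE; ring.
  have -> : dotv (t^-1 *: (x - x') - A^T *m q - grad f2 x) (xs - p) =
      - (t^-1 * dotv (x - x') (p - xs)) + (dotv (A *m p) q - dotv (A *m xs) q)
      + (dotv (grad f2 x) (p - x) - dotv (grad f2 x) (xs - x)).
    have -> : dotv (A *m p) q - dotv (A *m xs) q = dotv (A^T *m q) (p - xs).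
      by rewrite (dotvC (A^T *m q)) -dotv_trmx mulmxBr dotvBl.
    rewrite -dotvBr; have -> : p - x - (xs - x) = p - xs by rewrite opprB addrA subrK.
    rewrite -(opprB p xs) dotvNr; move: (p - xs) (x - x') => d e.
    rewrite !dotvBl dotvZl.
    by ring.
  have vqE : dotv v q = s^-1 * dotv (y - q) q + dotv (A *m p) q.
    by rewrite /v dotvDl dotvZl.
  rewrite vqE in vq; rewrite /primal_gap -/w; lra.
Qed.

(* Young's inequality with weight [M / eta] balances a residual of order
   [eta^2 / M] against a distance to the saddle point of order [M]. *)
Lemma young_balance k (c M eta e d : R) (u v : 'cV[R]_k) :
  0 < c -> 0 < eta -> 1 <= M -> M * e <= eta ^+ 2 -> c * dotv u u <= e ->
  c * dotv v v <= M * d -> 2 * (c * dotv u v) <= eta * (1 + d).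
Proof.
move=> c0 eta0 M1 Me ue vd; have M0 : 0 < M by rewrite (lt_le_trans ltr01).
have := young u v (divr_gt0 M0 eta0) => /(ler_wpM2l (ltW c0)).
rewrite invf_div => y.
have : M / eta * (c * dotv u u) <= eta.
  rewrite mulrAC ler_pdivrMr // -expr2; apply: le_trans Me.
  by rewrite ler_pM2l.
have : eta / M * (c * dotv v v) <= eta * d.
  by rewrite mulrAC ler_pdivrMr // -mulrA ler_pM2l // [d * M]mulrC.
by move: y; lra.
Qed.

Lemma pd_step_gap (t s M eta D0 s0 : R) x y p q x' : 0 < t -> 0 < s ->
  s * t * opnorm A ^+ 2 < 1 -> t * Lf < 2 -> step t s x y p q x' ->
  0 < eta <= 1 -> 1 <= M -> 0 <= s0 ->
  M * sqnormV t s (x' - x) (q - y) <= eta ^+ 2 ->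
  sqnormV t s (x - xs) (y - ys) <= M * D0 -> s^-1 <= M * s0 ->
  distance_to (edom g) (A *m p) <= (1 + s0) * eta /\
  `|primal_gap p| <= ((2 * Lg + enorm ys) * (1 + s0) + 7 + 2 * D0) * eta.
Proof.
move=> t0 s_gt0 stA tL st /andP[eta0 eta1] M1 s0_ge0 Mrho MD Ms.
have [h1 h2 h3] := pd_step_primal t0 s_gt0 st.
have [r1 _] := pd_step_residual t0 s_gt0 stA st.
have it0 : 0 < t^-1 by rewrite invr_gt0.
have si0 : 0 < s^-1 by rewrite invr_gt0.
have M0 : 0 < M by rewrite (lt_le_trans ltr01).
move: r1 Mrho; set rho := sqnormV _ _ _ _ => r1 Mrho.
have rho0 : 0 <= rho by exact: sqnormV_ge0.
have rhoE : rho = t^-1 * dotv (x - x') (x - x') + s^-1 * dotv (y - q) (y - q).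
  by rewrite /rho /sqnormV !sqr_enorm -(opprB x) -(opprB y) !(dotvNl, dotvNr) !opprK.
have xx0 : 0 <= t^-1 * dotv (x - x') (x - x') by rewrite mulr_ge0 ?dotv_ge0 // ltW.
have yy0 : 0 <= s^-1 * dotv (y - q) (y - q) by rewrite mulr_ge0 ?dotv_ge0 // ltW.
move: MD; rewrite /sqnormV !sqr_enorm => MD.
have x0 : 0 <= t^-1 * dotv (x - xs) (x - xs) by rewrite mulr_ge0 ?dotv_ge0 // ltW.
have y0 : 0 <= s^-1 * dotv (y - ys) (y - ys) by rewrite mulr_ge0 ?dotv_ge0 // ltW.
have rhoM : rho <= M * rho by rewrite ler_peMl.
have eta2 : eta ^+ 2 <= eta by rewrite expr2 ler_piMl // ltW.
move: h1 h2 h3; set b := enorm _ => h1 h2 h3.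
(* Here [b ^+ 2 <= M * s0 * rho <= s0 * eta ^+ 2], and [s0 <= (1 + s0) ^+ 2] avoids a square
   root. *)
have bd : b <= (1 + s0) * eta.
  apply: enorm_le_sqr; first by rewrite mulr_ge0 ?addr_ge0 // ltW.
  rewrite dotvZl dotvZr; apply: (@le_trans _ _ (s0 * eta ^+ 2)).
    apply: (@le_trans _ _ (M * s0 * rho)); last by rewrite mulrAC mulrC ler_wpM2l.
    by apply: ler_pM => //; [exact: ltW | lra].
  rewrite exprMn ler_wpM2r ?sqr_ge0 //; nra.
have b0 : 0 <= b by exact: enorm_ge0.
have ys0 := enorm_ge0 ys.
split; first exact: le_trans h1 bd.
(* Splitting at [x] gives at most [4 * rho + 2 * M * D0], and [rho <= eta ^+ 2 <= 1 <= M]. This and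
   its dual analogue contribute [5 + 2 * D0] to the final constant; [Lpx] adds the missing 2. *)
have yx : 2 * (t^-1 * dotv (x - x') (p - xs)) <= eta * (1 + (4 + 2 * D0)).
  apply: (young_balance it0 eta0 M1 Mrho); first by lra.
  have -> : p - xs = (p - x) + (x - xs) by rewrite subrKA.
  have := mulr_ge0 (ltW it0) (dotv_ge0 ((p - x) - (x - xs))).
  move: (p - x) (x - xs) r1 MD x0 => d e r1 MD x0; rewrite !dotv_linE (dotvC e d); nra.
have yy : 2 * (s^-1 * dotv (y - q) (q - ys)) <= eta * (1 + (4 + 2 * D0)).
  apply: (young_balance si0 eta0 M1 Mrho); first by lra.
  have -> : q - ys = (y - ys) - (y - q) by apply/matrixP => i j; rewrite !mxE; ring.
  have := mulr_ge0 (ltW si0) (dotv_ge0 ((y - q) + (y - ys))).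
  move: (y - q) (y - ys) rhoE MD y0 yy0 => d e rhoE MD y0' yy0'.
  rewrite !dotv_linE (dotvC e d); nra.
have yys : s^-1 * dotv (y - q) ys <= enorm ys * b.
  rewrite -dotvZl mulrC; apply: le_trans (ler_norm _) _.
  exact: cauchy_schwarz.
have qE : s^-1 * dotv (y - q) q =
    s^-1 * dotv (y - q) (q - ys) + s^-1 * dotv (y - q) ys.
  by rewrite -mulrDr -dotvDr subrK.
have Lpx : Lf / 2 * dotv (p - x) (p - x) <= 2 * rho.
  apply: le_trans r1; rewrite ler_wpM2r ?dotv_ge0 //.
  by rewrite -[t^-1]mul1r ler_pdivlMr //; lra.
have D0_ge0 : 0 <= D0 by rewrite -(pmulr_rge0 _ M0); lra.
have yb : enorm ys * b <= enorm ys * ((1 + s0) * eta) by rewrite ler_wpM2l.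
have Lb : Lg * b <= Lg * ((1 + s0) * eta) by rewrite ler_wpM2l.
have De : 0 <= D0 * eta by rewrite mulr_ge0 // ltW.
have Lge : 0 <= Lg * ((1 + s0) * eta) by apply: le_trans Lb; rewrite mulr_ge0.
rewrite ler_norml; apply/andP; split; first by lra.
by rewrite qE in h3; lra.
Qed.

End GapBounds.

(** * Effect of an update on the step sizes and on the metric *)

Section AdaptiveSteps.
Variables (R : realType) (r : R).
Hypothesis r_gt1 : 1 < r.

Lemma update_ratio (t s : R) (e : int) : 0 < t -> 0 < s -> e = 1 \/ e = -1 ->
  [/\ t <= r * (t * r ^ e), t * r ^ e <= r * t, s <= r * (s * r ^ (- e)) &
      s * r ^ (- e) <= r * s].
Proof.
have r0 : 0 < r := lt_trans ltr01 r_gt1.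
have rV0 : 0 < r^-1 by rewrite invr_gt0.
have rV1 : r^-1 < 1 by rewrite invf_lt1.
have rr : r * r^-1 = 1 by rewrite divff // gt_eqF.
have hA a : 0 < a -> a <= r * (a * r).
  by move=> a0; rewrite mulrCA ler_peMr ?ltW // mulr_egt1.
have hC a : a <= r * (a * r^-1) by rewrite mulrCA rr mulr1.
have hD a : 0 < a -> a * r^-1 <= r * a.
  by move=> a0; rewrite mulrC ler_pM2r // ltW // (lt_trans rV1).
move=> t0 s0 [] ->; rewrite ?opprK expr1z exprN1; split; auto;
  by rewrite mulrC.
Qed.

Lemma sqnormV_ratio m n (t s t' s' : R) (u : 'cV[R]_n) (v : 'cV[R]_m) :
  0 < t -> 0 < s -> 0 < t' -> 0 < s' -> t <= r * t' -> s <= r * s' ->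
  sqnormV t' s' u v <= r * sqnormV t s u v.
Proof.
move=> t0 s0 t'0 s'0 tr sr.
have inv (a b : R) : 0 < a -> 0 < b -> a <= r * b -> b^-1 <= r * a^-1.
  by move=> a0 b0 ab; rewrite ler_pdivlMr // mulrC ler_pdivrMr.
rewrite /sqnormV mulrDr; apply: lerD; rewrite [leRHS]mulrA;
  by apply: ler_wpM2r; rewrite ?sqr_ge0 //; exact: inv.
Qed.

End AdaptiveSteps.

Lemma cvg_le_linear (R : realType) (F : nat -> R) (K : R) : 0 <= K ->
  (forall eta, 0 < eta <= 1 -> exists N, forall k, (N <= k)%N -> `|F k| <= K * eta) ->
  F @ \oo --> 0.
Proof.
move=> K0 h; apply/cvgrPdist_le => e e0.
have K1 : 0 < K + 1 by lra.
pose eta := Num.min 1 (e / (K + 1)).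
have [|N hN] := h eta.
  by rewrite lt_min ltr01 divr_gt0 //= ge_min lexx.
exists N => // k /= Nk; rewrite sub0r normrN; apply: le_trans (hN _ Nk) _.
apply: (@le_trans _ _ (K * (e / (K + 1)))).
  by rewrite ler_wpM2l // ge_min lexx orbT.
by rewrite mulrA ler_pdivrMr //; nra.
Qed.

Unset Implicit Arguments.

Theorem theorem1 (R : realType) (m n : nat) (A : 'M[R]_(m, n))
  (f : 'cV[R]_n -> \bar R) (f2 : 'cV[R]_n -> R) (g : 'cV[R]_m -> \bar R)
  (Lf : R)
  (f_proper : eproper f) (f_convex : econvex f)
  (f_lsc : lower_semicontinuous f)
  (g_proper : eproper g) (g_convex : econvex g)
  (g_lsc : lower_semicontinuous g)
  (f2_convex : convex_function [set: 'cV[R]_n] f2)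
  (f2_diff : forall v, differentiable f2 v)
  (Lf_ge0 : 0 <= Lf)
  (f2_lip : forall v w, enorm (grad f2 v - grad f2 w) <= Lf * enorm (v - w))
  (qualification :
     relint [set w - A *m v | w in edom g & v in edom f] 0)
  (xs : 'cV[R]_n) (ys : 'cV[R]_m) (zs_saddle : saddle_point A f f2 g xs ys)
  (g_lip : lipschitz_on_edom g)
  (tau sigma : nat -> R)
  (tau_gt0 : forall k, 0 < tau k) (sigma_gt0 : forall k, 0 < sigma k)
  (step_A : forall k, sigma k * tau k * opnorm A ^+ 2 < 1)
  (step_f2 : forall k, tau k * Lf < 2)
  (x xbar : nat -> 'cV[R]_n) (y : nat -> 'cV[R]_m)
  (iter : tri_pd A f f2 g tau sigma x xbar y)
  (r delta : R) (r_gt1 : 1 < r) (delta_gt0 : 0 < delta)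
  (delta_r : delta * r < 1)
  (N : option nat) (s : nat -> nat) (u : nat -> int)
  (steps : adaptive_steps tau sigma x y r delta N s u) :
  distance_to (edom g) (A *m xbar k) @[k --> \oo] --> (0 : R) /\
  (f (xbar k) + (f2 (xbar k))%:E + g (proj_on (edom g) (A *m xbar k))
     - (f xs + (f2 xs)%:E + g (A *m xs)))%E @[k --> \oo] --> (0 : \bar R)%E.

Proof.
have [Lg Lg0 Lg_lip] := lipschitz_on_edom_ge0 g_lip.
pose gc := fenchel_conj g.
have r0 : 0 < r := lt_trans ltr01 r_gt1.
have st k : pd_step A f gc (grad f2) (tau k) (sigma k) (x k) (y k) (xbar k.+1)
    (y k.+1) (x k.+1).
  exact: (tri_pd_step f_proper f_convex g_proper zs_saddle k tau_gt0 sigma_gt0 iter).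
have sad t s' : pd_step A f gc (grad f2) t s' xs ys xs ys xs.
  exact: (saddle_pd_step f_proper f_convex g_proper f2_diff f2_lip zs_saddle).
have shift := grad_mono_shift f2_diff Lf_ge0 f2_lip f2_convex.
pose rho k := sqnormV (tau k) (sigma k) (x k.+1 - x k) (y k.+1 - y k).
pose D k := sqnormV (tau k) (sigma k) (x k - xs) (y k - ys).
(* Both sides use the metric of step [k]; passing to [D k.+1] is free inside a phase and costs a
   factor [r] at an update. *)
have Dstep k : sqnormV (tau k) (sigma k) (x k.+1 - xs) (y k.+1 - ys) <= D k.
  exact: (pd_step_nonexpansive shift (tau_gt0 k) (sigma_gt0 k) (step_A k)
    (step_f2 k) (st k) (sad _ _)).
case: steps => s0 phase upd dec1 dec.
have same l k : is_instant N l -> (s l <= k)%N ->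
    (is_instant N l.+1 -> (k.+1 < s l.+1)%N) ->
    tau k.+1 = tau k /\ sigma k.+1 = sigma k.
  move=> il lk hk; have [-> ->] := phase l k il lk (fun i => ltnW (hk i)).
  by have [-> ->] := phase l k.+1 il (leqW lk) hk.
have before l k : is_instant N l.+1 -> s l.+1 = k.+1 ->
    tau k = tau (s l) /\ sigma k = sigma (s l).
  move=> il sk; apply: phase; first exact: is_instantS.
    by rewrite -ltnS -sk; have [] := upd l il.
  by rewrite sk.
(* The step sizes of instant [s l] are still in force at the step leading to [s l.+1], so the tested
   residual is measured in the metric of that step. *)
have res l : is_instant N l.+1 -> sqres tau sigma x y (s l) (s l.+1) = rho (s l.+1).-1.
  move=> il; have [sl _ _ _] := upd l il.
  have [k sk] : exists k, s l.+1 = k.+1 by case: (s l.+1) sl => // k _; exists k.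
  by have [tk sk'] := before _ _ il sk; rewrite /sqres /rho sk /= tk sk'.
have rate := @residual_beats_growth R N s rho D (fun k => (sigma k)^-1) r delta
  (216 * r) r_gt1 delta_gt0 delta_r.
have {}rate eta : 0 < eta -> exists K, forall k, (K <= k)%N -> exists2 M, 1 <= M &
    [/\ M * rho k <= eta, D k <= M * D 0%N & (sigma k)^-1 <= M * (sigma 0%N)^-1].
  apply: rate => //.
  - by lra.
  - by move=> k; exact: sqnormV_ge0.
  - by move=> k; exact: sqnormV_ge0.
  - by move=> l /upd [].
  - move=> l k il lk hk; have [tk sk] := same l k il lk hk; split.
    + rewrite /rho tk sk; have := st k.+1; rewrite tk sk => st1.
      exact: (pd_step_nonexpansive shift (tau_gt0 k) (sigma_gt0 k) (step_A k)
        (step_f2 k) st1 (st k)).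
    + by rewrite /D tk sk.
    + by rewrite sk.
  - move=> l k il sk; have [tk sk'] := before l k il sk.
    have [_ ul ut us] := upd l il; rewrite sk -tk in ut; rewrite sk -sk' in us.
    have [c1 c2 c3 c4] := update_ratio r_gt1 (tau_gt0 k) (sigma_gt0 k) ul.
    rewrite -ut -us in c1 c2 c3 c4; split.
    + exact: (pd_step_change Lf_ge0 f2_lip (tau_gt0 k) (sigma_gt0 k) (tau_gt0 k.+1)
        (sigma_gt0 k.+1) r_gt1 c1 c2 c4 (step_A k) (step_A k.+1)
        (step_f2 k) (st k) (st k.+1)).
    + apply: (@le_trans _ _ (r * sqnormV (tau k) (sigma k) (x k.+1 - xs) (y k.+1 - ys))).
        exact: sqnormV_ratio.
      by rewrite ler_pM2l.
    + by rewrite ler_pdivlMr // mulrC ler_pdivrMr.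
  - by move=> i1; have := dec1 i1; rewrite res // s0.
  - move=> [//|l] l0 il; have := dec l.+1 l0 il; rewrite res //= res //.
    exact: is_instantS.
  - move=> q Nq; have iq : is_instant N q by rewrite Nq /=.
    have niq : is_instant N q.+1 -> False by rewrite Nq /= ltnn.
    (* The largest values of [theta] that the two conditions of [pd_step_fejer] allow. *)
    pose a := (1 - tau (s q) * Lf / 2) / 2.
    pose b := (1 - sigma (s q) * tau (s q) * opnorm A ^+ 2) / 3.
    have a0 : 0 < a by rewrite /a; have := step_f2 (s q); lra.
    have b0 : 0 < b by rewrite /b; have := step_A (s q); lra.
    have th0 : 0 < Num.min a b by rewrite lt_min a0.
    exists (Num.min a b) => // k qk.
    have [tk sk] := phase q k iq qk (fun i => False_ind _ (niq i)).
    have [tk1 sk1] := same q k iq qk (fun i => False_ind _ (niq i)).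
    rewrite /D tk1 sk1; apply: (pd_step_fejer shift) (st k) (sad _ _) => //.
    + exact: ltW.
    + have : Num.min a b <= a by rewrite ge_min lexx.
      by rewrite tk /a; lra.
    + have : Num.min a b <= b by rewrite ge_min lexx orbT.
      by rewrite tk sk /b; lra.
pose si := (sigma 0%N)^-1; have si0 : 0 <= si by rewrite invr_ge0 ltW.
pose K := (2 * Lg + enorm ys) * (1 + si) + 7 + 2 * D 0%N.
have D00 : 0 <= D 0%N by exact: sqnormV_ge0.
have K0 : 0 <= K.
  have e0 := enorm_ge0 ys.
  have : 0 <= (2 * Lg + enorm ys) * (1 + si) by apply: mulr_ge0; lra.
  by rewrite /K; lra.
pose gap p := primal_gap A f f2 g xs p.
have bounds eta : 0 < eta <= 1 -> exists K1, forall k, (K1 <= k)%N ->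
    distance_to (edom g) (A *m xbar k) <= (1 + si) * eta /\ `|gap (xbar k)| <= K * eta.
  (* The gaps are of the order of the root of the weighted squared residual, hence [eta ^+ 2] here;
     the shift to [K1.+1] is due to step [k] producing [xbar k.+1]. *)
  move=> /andP[eta0 eta1]; have [K1 hK1] := rate (eta ^+ 2) ltac:(by rewrite exprn_gt0).
  exists K1.+1 => -[//|k] Kk; have [M M1 [Mr MD Ms]] := hK1 k Kk.
  by apply: (pd_step_gap f_proper f_convex g_proper g_convex g_lsc g_lip f2_convex f2_diff
    f2_lip zs_saddle Lg0 Lg_lip (tau_gt0 k) (sigma_gt0 k) (step_A k) (step_f2 k)
    (st k) _ M1 si0 Mr MD Ms); rewrite eta0.
split.
  apply: (@cvg_le_linear _ _ (1 + si)) => [|eta /bounds[K1 hK1]]; first by lra.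
  exists K1 => k /hK1 [h _]; rewrite ger0_norm //.
  apply: lb_le_inf; last by move=> _ [w _ <-]; exact: enorm_ge0.
  by have [_ [w gw]] := g_proper; exists (enorm (A *m xbar k - w)); exists w.
have gap0 : gap (xbar k) @[k --> \oo] --> 0.
  by apply: (cvg_le_linear K0) => eta /bounds[K1 hK1]; exists K1 => k /hK1 [].
have fxs : edom f xs by case: zs_saddle.
have [gxs _] := saddle_value f_proper g_proper g_convex g_lsc g_lip zs_saddle.
(* At index 0 the point [xbar 0] is arbitrary and [f] may be infinite there. *)
have gapE k : (0 < k)%N -> (f (xbar k) + (f2 (xbar k))%:E
    + g (proj_on (edom g) (A *m xbar k)) - (f xs + (f2 xs)%:E + g (A *m xs)))%E
    = (gap (xbar k))%:E.
  case: k => // k _; have [[fp _] _ _] := st k.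
  have [gp _] := proj_on_edomP (A *m xbar k.+1) g_proper g_lsc g_lip.
  rewrite /gap /primal_gap (edom_fineK f_proper fp) (edom_fineK g_proper gp).
  by rewrite (edom_fineK f_proper fxs) (edom_fineK g_proper gxs).
apply: cvg_EFin.
  by exists 1%N => // k /= k1; rewrite gapE.
apply: cvg_trans gap0; apply: near_eq_cvg.
by exists 1%N => // k /= k1; rewrite gapE.
Qed.
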